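(* Let $G$ be a simple graph and $s$ a positive integer. Assume that the set $\mathcal{PC}(G)$ of primitive even closed walks of $G$ can be arranged as $\{C_1,\ldots,C_r\}$ such that the following conditions are satisfied: (1) For some monomial order $\prec$ on $\mathbb{K}[E]$, the monomial ideal $\mathrm{in}_\prec(I_G)$ has $s$-regular quotients with respect to the order $u_1,u_2,\ldots,u_r$, where $u_i=\mathrm{in}_\prec(f_{C_i})$ for $i=1,\ldots,r$. (2) There are pairwise distinct positive integers $d_1,\ldots,d_m$ and integers $0=k_0<k_1<\cdots<k_m=r$ such that $\deg(u_p)=d_i$ whenever $k_{i-1}+1\le p\le k_i$, for $i=1,\ldots,m$, and such that for each $i=1,\ldots,m$ there exists an induced subgraph $G_i$ of $G$ with $\mathcal{PC}(G_i)=\{C_\ell: 1\le \ell\le k_i\}$. (3) $d_k-d_\ell\ne s$ for any pair $k,\ell$ with $1\le k<\ell\le m$. Then $\beta_{i,j}(I_G)=\beta_{i,j}(\mathrm{in}_\prec(I_G))$ for all $i,j\ge 0$.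
   Context: $\mathbb{K}$ is a field. For a (finite) simple graph $G$ with vertex set $V=\{x_1,\ldots,x_n\}$ and edge set $E$, let $\mathbb{K}[E]$ be the standard graded polynomial ring whose variables are the edges of $G$, and let $\phi:\mathbb{K}[E]\to\mathbb{K}[x_1,\ldots,x_n]$ be the $\mathbb{K}$-algebra homomorphism sending an edge $e=\{x_a,x_b\}$ to $x_ax_b$. The toric ideal of $G$ is $I_G=\ker\phi$. An even closed walk $W$ of $G$ with consecutive edges $e_1,e_2,\ldots,e_{2q}$ has associated binomial $f_W=\prod_{j=1}^q e_{2j-1}-\prod_{j=1}^q e_{2j}\in I_G$. A binomial $u-v\in I_G$ is primitive if there is no other binomial $u'-v'\in I_G$ with $u'\mid u$ and $v'\mid v$; $W$ is a primitive even closed walk if $f_W$ is a primitive binomial. $\mathcal{PC}(G)$ is the (finite) set of primitive even closed walks of $G$, where walks whose associated binomials agree up to sign are identified. A monomial ideal $J$ has $a$-regular quotients with respect to the order $u_1,\ldots,u_r$ if $J$ is minimally generated by the monomials $u_1,\ldots,u_r$ and, for each $i=2,\ldots,r$, the colon ideal $(u_1,\ldots,u_{i-1}):u_i$ is generated by a regular sequence of monomials all of degree $a$. $\mathrm{in}_\prec(I)$ is the initial ideal of $I$ and $\mathrm{in}_\prec(f)$ the initial monomial of $f$; $\beta_{i,j}(M)=\dim_{\mathbb{K}}\mathrm{Tor}_i^{\mathbb{K}[E]}(M,\mathbb{K})_j$. *)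

(* Defs.v *)
From Stdlib Require Import ClassicalEpsilon.
From HB Require Import structures.
From mathcomp Require Import all_boot all_order all_algebra.
From mathcomp Require Export mpoly.

Set Implicit Arguments.
Unset Strict Implicit.
Unset Printing Implicit Defensive.

Import GRing.Theory.
Local Open Scope ring_scope.

Section Ideals.
Variables (K : fieldType) (N : nat).
Implicit Types (I J A : {mpoly K[N]} -> Prop) (f p : {mpoly K[N]}).

Definition ideal_gen A : {mpoly K[N]} -> Prop := fun p =>
  exists s : seq ({mpoly K[N]} * {mpoly K[N]}),
    (forall x, x \in s -> A x.2) /\ p = \sum_(x <- s) x.1 * x.2.

Definition colon I f : {mpoly K[N]} -> Prop := fun p => I (p * f).

Definition same_ideal I J := forall p, I p <-> J p.

(* f_0, f_1, ... is regular on the polynomial ring S: each f_k is a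
   nonzerodivisor on S/(f_0, ..., f_(k-1)), and (f_0, f_1, ...) <> S. *)
Definition regular_sequence (fs : seq {mpoly K[N]}) :=
  (forall k, (k < size fs)%N -> forall p,
     ideal_gen (fun f => f \in take k fs) (p * nth 0 fs k) ->
     ideal_gen (fun f => f \in take k fs) p)
  /\ ~ ideal_gen (fun f => f \in fs) 1.

End Ideals.

Section MonomialOrder.
Variable N : nat.

Definition monomial_order (le : rel 'X_{1..N}) :=
  [/\ total le, antisymmetric le, transitive le,
      forall a b c : 'X_{1..N}, le a b -> le (a + c)%MM (b + c)%MM
    & forall a, le 0%MM a].

(* The exponent of the initial monomial of f; since 0 is the least element of
   a monomial order, this is the largest element of the support if f != 0. *)
Definition in_mnm (K : fieldType) (le : rel 'X_{1..N}) (f : {mpoly K[N]}) :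
    'X_{1..N} :=
  foldr (fun a b => if le a b then b else a) 0%MM (msupp f).

Definition initial_ideal (K : fieldType) (le : rel 'X_{1..N})
    (I : {mpoly K[N]} -> Prop) : {mpoly K[N]} -> Prop :=
  ideal_gen (fun g => exists f, [/\ I f, f != 0 & g = 'X_[in_mnm le f]]).

Definition regular_quotients (K : fieldType) (J : {mpoly K[N]} -> Prop)
    (a r : nat) (u : 'I_r -> 'X_{1..N}) :=
  [/\ same_ideal J (ideal_gen (fun f => exists i, f = 'X_[u i])),
      forall i, ~ ideal_gen (fun f : {mpoly K[N]} =>
                    exists2 j, j != i & f = 'X_[u j]) 'X_[u i]
    & forall i : 'I_r, (0 < i)%N ->
        exists t : seq 'X_{1..N},
          [/\ forall x, x \in t -> mdeg x = a,
              regular_sequence [seq 'X_[x] : {mpoly K[N]} | x <- t]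
            & same_ideal
                (colon (ideal_gen (fun f : {mpoly K[N]} =>
                          exists2 j : 'I_r, (j < i)%N & f = 'X_[u j]))
                       'X_[u i])
                (ideal_gen (fun f => f \in [seq 'X_[x] | x <- t]))]].

End MonomialOrder.

(* Graded Betti numbers.  A free module F_i = \bigoplus_c S(-gdeg i c) of finite
   rank is the space of row vectors of length rk i, and a map F_(i+1) -> F_i
   is right multiplication by a matrix.  The augmentation maps F_0 to S. *)

Section Betti.
Variables (K : fieldType) (N : nat).

Record free_complex := FreeComplex {
  rk : nat -> nat;
  gdeg : forall i, 'I_(rk i) -> nat;
  diff : forall i, 'M[{mpoly K[N]}]_(rk i.+1, rk i);
  aug : 'cV[{mpoly K[N]}]_(rk 0)
}.

(* The matrix D is a degree 0 map between free modules whose bases have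
   degrees dr and dc. *)
Definition graded_mx (a b : nat) (dr : 'I_a -> nat) (dc : 'I_b -> nat)
    (D : 'M[{mpoly K[N]}]_(a, b)) :=
  forall r c t, t \in msupp (D r c) -> (mdeg t + dc c = dr r)%N.

Definition graded_resolution (I : {mpoly K[N]} -> Prop) (F : free_complex) :=
  [/\ (forall i, graded_mx (@gdeg F i.+1) (@gdeg F i) (diff F i))
        /\ graded_mx (@gdeg F 0) (fun=> 0%N) (aug F),
      forall p, I p <-> exists v : 'rV_(rk F 0), p = (v *m aug F) 0 0,
      forall v : 'rV_(rk F 0),
        v *m aug F = 0 <-> exists w : 'rV_(rk F 1), v = w *m diff F 0
    & forall i (v : 'rV_(rk F i.+1)),
        v *m diff F i = 0 <-> exists w : 'rV_(rk F i.+2), v = w *m diff F i.+1].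

(* F_i \otimes K = K^(rk i), where K is the quotient of S by the variables. *)
Definition diffK (F : free_complex) (i : nat) : 'M[K]_(rk F i.+1, rk F i) :=
  map_mx (mcoeff 0%MM) (diff F i).

Definition cycles (F : free_complex) (i : nat) : 'M[K]_(rk F i) :=
  match i return 'M[K]_(rk F i) with
  | 0 => 1%:M
  | i'.+1 => kermx (diffK F i')
  end.

Definition degree_part (F : free_complex) (i j : nat) : 'M[K]_(rk F i) :=
  diag_mx (\row_c (gdeg (i := i) c == j)%:R).

(* The dimension of H_i(F \otimes K)_j. *)
Definition tor_dim (F : free_complex) (i j : nat) : nat :=
  (\rank (cycles F i :&: degree_part F i j)%MS
   - \rank (diffK F i :&: degree_part F i j)%MS)%N.

(* \beta_{i,j}(I) = dim_K Tor_i(I, K)_j, computed from a graded free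
   resolution of I by modules of finite rank; it does not depend on the
   resolution. *)
Definition betti (I : {mpoly K[N]} -> Prop) (i j : nat) : nat :=
  epsilon (inhabits 0%N)
    (fun b => exists2 F, graded_resolution I F & b = tor_dim F i j).

End Betti.

Record sgraph (V : finType) := SGraph {
  adj : rel V;
  adj_sym : ssrbool.symmetric adj;
  adj_irrefl : irreflexive adj
}.

Section Induced.
Variables (V : finType) (G : sgraph V) (W : {set V}).

Definition induced_adj : rel {x : V | x \in W} :=
  fun x y => adj G (val x) (val y).

Fact induced_sym : ssrbool.symmetric induced_adj.
Proof. by move=> x y; apply: adj_sym. Qed.

Fact induced_irrefl : irreflexive induced_adj.
Proof. by move=> x; apply: adj_irrefl. Qed.

Definition induced : sgraph {x : V | x \in W} :=
  SGraph induced_sym induced_irrefl.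

End Induced.

Section ToricIdeal.
Variables (K : fieldType) (V : finType) (G : sgraph V).

Definition edges : {set {set V}} :=
  [set e | [exists x, exists y, adj G x y && (e == [set x; y])]].

(* The variables of K[E] are indexed by 'I_#|edges|, through enum_val, and
   those of K[V] by 'I_#|V|, through enum_rank. *)
Definition toric_map (p : {mpoly K[#|edges|]}) : {mpoly K[#|V|]} :=
  mmap (@mpolyC #|V| K)
    (fun i : 'I_#|edges| => \prod_(x in enum_val i) 'X_(enum_rank x)) p.

Definition toric_ideal (p : {mpoly K[#|edges|]}) : Prop := toric_map p = 0.

(* A closed walk (v_0, ..., v_(q-1), v_0) is given by the sequence
   v_0, ..., v_(q-1). *)
Definition even_closed_walk (w : seq V) :=
  [/\ (0 < size w)%N, ~~ odd (size w) & cycle (adj G) w].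

Definition walk_edges (w : seq V) : seq {set V} :=
  [seq [set p.1; p.2] | p <- zip w (rot 1 w)].

Definition edge_mnm (e : {set V}) : 'X_{1..#|edges|} :=
  [multinom ((enum_val i == e) : nat) | i < #|edges|].

(* The product of the edges e_1, e_3, ... and of the edges e_2, e_4, ... *)
Definition walk_mnm1 (w : seq V) : 'X_{1..#|edges|} :=
  (\sum_(j < (size w)./2) edge_mnm (nth set0 (walk_edges w) j.*2))%MM.
Definition walk_mnm2 (w : seq V) : 'X_{1..#|edges|} :=
  (\sum_(j < (size w)./2) edge_mnm (nth set0 (walk_edges w) j.*2.+1))%MM.

Definition walk_binomial (w : seq V) : {mpoly K[#|edges|]} :=
  'X_[walk_mnm1 w] - 'X_[walk_mnm2 w].

(* The two monomials of a binomial are distinct: otherwise 1 - 1 would prevent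
   every binomial from being primitive. *)
Definition toric_binomial (u v : 'X_{1..#|edges|}) :=
  u <> v /\ toric_ideal ('X_[u] - 'X_[v]).

Definition primitive_binomial (u v : 'X_{1..#|edges|}) :=
  toric_binomial u v /\
  forall u' v' : 'X_{1..#|edges|}, toric_binomial u' v' ->
    (u' <= u)%MM -> (v' <= v)%MM -> u' = u /\ v' = v.

Definition primitive_walk (w : seq V) :=
  even_closed_walk w /\ primitive_binomial (walk_mnm1 w) (walk_mnm2 w).

Definition walk_equiv (w w' : seq V) :=
  walk_binomial w = walk_binomial w' \/ walk_binomial w = - walk_binomial w'.

(* PC(G) = {C_0, ..., C_(r-1)}, the C_i being pairwise distinct in PC(G). *)
Definition arranges_PC (r : nat) (C : 'I_r -> seq V) :=
  [/\ forall i, primitive_walk (C i),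
      forall w, primitive_walk w -> exists i, walk_equiv w (C i)
    & forall i j, walk_equiv (C i) (C j) -> i = j].

End ToricIdeal.

(* PC(G[W]) = {C_l : l < k}, as subsets of PC(G). *)
Definition PC_induced_is (K : fieldType) (V : finType) (G : sgraph V)
    (W : {set V}) (r : nat) (C : 'I_r -> seq V) (k : nat) :=
  (forall w : seq {x : V | x \in W}, primitive_walk K (induced G W) w ->
     exists2 l : 'I_r, (l < k)%N & walk_equiv K G (map val w) (C l))
  /\ (forall l : 'I_r, (l < k)%N ->
     exists2 w : seq {x : V | x \in W}, primitive_walk K (induced G W) w
       & walk_equiv K G (map val w) (C l)).

(* Main.v *)
Require Import Defs.
From mathcomp Require Import all_boot all_order all_algebra.
From mathcomp Require Import zify.
From Stdlib Require Import ClassicalEpsilon.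

Set Implicit Arguments.
Unset Strict Implicit.
Unset Printing Implicit Defensive.

Import GRing.Theory.
Local Open Scope ring_scope.

(** Why the theorem holds.

    Write J for the initial ideal, generated by u_1, ..., u_r, and t_p for the
    regular sequence of degree s that generates (u_1, ..., u_(p-1)) : u_p.  The
    filtration of J by the ideals (u_1, ..., u_p) has quotients resolved by the
    Koszul complexes of the t_p, and these glue to a free resolution of J with
    one basis element for each pair (p, A), where A is a subset of t_p.  Its
    homological degree is #|A| and its internal degree deg u_p + s #|A|.  The
    point of the proof is that the toric ideal I has a resolution with the same
    basis, and that both resolutions are minimal, so that both families of Betti
    numbers count the pairs (p, A) with given degrees.

    The two resolutions come from a single construction, in the manner of
    Schreyer.  A term x^a e_(p, A) has a value, the monomial x^a u_p prod A, and
    terms are compared by value, then by p, then by the lexicographic order of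
    A.  The differential of e_(p, A) is required to have its largest term at
    (p, A minus its least element) and to be supported on terms that are not
    larger.  Whenever u_p divides a monomial v, let T be the set of elements of
    t_p that divide v / u_p: the terms of value v over p form the simplex on T,
    and pairing A with A + min T matches every term that is not the largest term
    of a cycle with one that is.  This combinatorial property ([schreyer_frame],
    proved in [koszul_schreyer]) is all that is needed to build the differential
    level by level and to prove exactness ([frame_differential],
    [cycle_boundary]); at level 0 it is completed by the hypothesis that every
    nonzero element of the ideal has an initial monomial divisible by some u_p.

    The construction also respects blocks: the differential of e_(p, A) only
    involves indices q whose block is at most that of p.  For I this needs the
    initial monomial condition for the ideals attached to the induced subgraphs
    G_i, and it comes from the fact that primitive binomials form a Groebner
    basis ([graver_divides]): two distinct monomials with the same vertex
    degrees, equal outside G_i, differ by the ends of an alternating closed walk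
    of G_i, which may be taken primitive and with its initial monomial dividing
    the larger of the two.  A constant entry of the differential from (p, A) to
    (q, B) would give deg u_q - deg u_p = s with the block of q at most that of
    p, which is what the condition on the differences of the block degrees
    excludes.  So both resolutions are minimal.

    Finally the dimension of Tor read off from a resolution does not depend on
    it ([tor_dim_le], by the comparison theorem), which turns the equality for
    these two resolutions into the equality of Betti numbers. *)

(** * Coefficients of polynomials and initial monomials *)

Section Coefficients.
Variables (K : fieldType) (N : nat).
Implicit Types (p q : {mpoly K[N]}) (a b k : 'X_{1..N}).

Lemma submm a : (a - a = 0)%MM.
Proof. by apply/mnmP => i; rewrite mnmBE mnm0E subnn. Qed.

Lemma lem0m a : (0 <= a)%MM.
Proof. by apply/mnm_lepP => i; rewrite mnm0E. Qed.

Lemma mcoeffM_ex p q k : (p * q)@_k != 0 ->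
  exists a b, [/\ (a + b)%MM = k, p@_a != 0 & q@_b != 0].
Proof.
rewrite -mcoeff_msupp => /msuppM_le /allpairsP [[a b] /= [ha hb ->]].
by exists a, b; rewrite -!mcoeff_msupp.
Qed.

(** A coefficient of a product to which a single pair of monomials contributes;
    this is how leading coefficients are multiplied below. *)
Lemma mcoeffM_uniq p q a b :
  (forall a' b', p@_a' != 0 -> q@_b' != 0 -> (a' + b')%MM = (a + b)%MM ->
     a' = a) ->
  (p * q)@_(a + b) = p@_a * q@_b.
Proof.
move=> h; rewrite {1}(mpolyE p) mulr_suml raddf_sum /=.
have E m : (p@_m *: 'X_[m] * q)@_(a + b) =
    if m == a then p@_a * q@_b else 0.
  rewrite -scalerAl mcoeffZ; case: eqP => [->|/eqP ne].
    by rewrite [_ * q]mulrC mcoeffMX.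
  apply/eqP; rewrite mulf_eq0; apply/orP.
  have [|pm] := boolP (p@_m == 0); [by left|right].
  apply/negPn/negP => /mcoeffM_ex [a' [b' [E]]].
  rewrite mcoeffX; have [E'|_] := eqVneq m a'; last by rewrite eqxx.
  by move=> _ qb; case/eqP: ne; apply: h pm qb _; rewrite E'.
rewrite (eq_bigr _ (fun m _ => E m)) -big_mkcond /=.
have [ha|ha] := boolP (a \in msupp p).
  rewrite -big_filter; suff -> : [seq i <- msupp p | i == a] = [:: a].
    by rewrite big_seq1.
  by rewrite filter_pred1_uniq.
rewrite big_seq_cond big1; last by move=> m /andP [hm /eqP E']; rewrite E' (negPf ha) in hm.
by rewrite (memN_msupp_eq0 ha) mul0r.
Qed.

Lemma mcoeffXM (q : {mpoly K[N]}) a k :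
  ('X_[a] * q)@_k = if (a <= k)%MM then q@_(k - a) else 0.
Proof.
rewrite mulrC; case: ifP => h.
  by rewrite -{1}(submK h) addmC mcoeffMX.
apply/eqP/negPn/negP => /mcoeffM_ex [a' [b' [E _]]].
rewrite mcoeffX; have [E'|] := eqVneq a b'; last by rewrite eqxx.
by move: h; rewrite -E E' lem_addl.
Qed.

Lemma mcoeff_sum_ex (I : finType) (F : I -> {mpoly K[N]}) k :
  (\sum_i F i)@_k != 0 -> exists i, (F i)@_k != 0.
Proof.
move=> h; apply/existsP; apply: contraNT h => /existsPn h.
by rewrite raddf_sum /= big1 // => i _; apply/eqP; rewrite -[_ == _]negbK h.
Qed.

End Coefficients.

Section InitialMonomial.
Variables (N : nat) (le : rel 'X_{1..N}) (hle : monomial_order le).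
Implicit Types a b c : 'X_{1..N}.

Lemma mo_total a b : le a b || le b a.
Proof. by case: hle => h _ _ _ _; apply: h. Qed.

Lemma mo_refl a : le a a.
Proof. by have := mo_total a a; rewrite orbb. Qed.

Lemma mo_anti a b : le a b -> le b a -> a = b.
Proof. by case: hle => _ h _ _ _ ab ba; apply: h; rewrite ab. Qed.

Lemma mo_trans b a c : le a b -> le b c -> le a c.
Proof. by case: hle => _ _ h _ _; apply: h. Qed.

Lemma mo_ge0 a : le 0%MM a.
Proof. by case: hle => _ _ _ _ h; apply: h. Qed.

Lemma mo_addr a b c : le (a + c)%MM (b + c)%MM = le a b.
Proof.
case: (hle) => _ _ _ h _; apply/idP/idP; last exact: h.
move=> h1; case/orP: (mo_total a b) => // h2.
by rewrite (addIm (mo_anti h1 (h _ _ c h2))) mo_refl.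
Qed.

Lemma mo_addl a b c : le (c + a)%MM (c + b)%MM = le a b.
Proof. by rewrite ![(c + _)%MM]addmC mo_addr. Qed.

Lemma mo_add a b c d : le a b -> le c d -> le (a + c)%MM (b + d)%MM.
Proof. by move=> h1 h2; apply: (@mo_trans (b + c)%MM); rewrite ?mo_addr ?mo_addl. Qed.

Variable K : fieldType.
Implicit Type f : {mpoly K[N]}.

Lemma in_mnm_max f a : f@_a != 0 -> le a (in_mnm le f).
Proof.
rewrite -mcoeff_msupp /in_mnm; elim: (msupp f) => //= b s IH.
rewrite inE; case: ifP => h /orP [/eqP ->|/IH h2] //; first exact: mo_refl.
have h' := mo_total b (foldr (fun a b => if le a b then b else a) 0%MM s).
by rewrite h in h'; apply: mo_trans h2 h'.
Qed.

Lemma in_mnm_mem f : f != 0 -> f@_(in_mnm le f) != 0.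
Proof.
rewrite -mcoeff_msupp -msupp_eq0 /in_mnm; case: (msupp f) => // b s _.
elim: s b => [|c s IH] b /=; first by rewrite (fun_if (fun x => x \in _)) !inE eqxx; case: ifP => // h; apply/eqP/esym/mo_anti => //; apply: mo_ge0.
by case: ifP => h; [rewrite inE IH orbT | rewrite inE eqxx].
Qed.

Lemma in_mnm_uniq f a : f@_a != 0 -> (forall b, f@_b != 0 -> le b a) ->
  in_mnm le f = a.
Proof.
move=> fa h; apply: mo_anti; last exact: in_mnm_max.
by apply/h/in_mnm_mem; apply: contraNneq fa => ->; rewrite mcoeff0.
Qed.

Lemma in_mnmN f : in_mnm le (- f) = in_mnm le f.
Proof.
have [->|nz] := eqVneq f 0; first by rewrite oppr0.
apply: in_mnm_uniq; first by rewrite mcoeffN oppr_eq0 in_mnm_mem.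
by move=> b; rewrite mcoeffN oppr_eq0; apply: in_mnm_max.
Qed.

Lemma in_mnmX a : in_mnm le ('X_[a] : {mpoly K[N]}) = a.
Proof.
apply: in_mnm_uniq => [|b]; rewrite mcoeffX ?eqxx ?oner_eq0 //.
by have [-> _|] := eqVneq a b; [apply: mo_refl | rewrite eqxx].
Qed.

Lemma in_mnm_binomial a b : a != b -> le b a ->
  in_mnm le ('X_[a] - 'X_[b] : {mpoly K[N]}) = a.
Proof.
move=> ne h; apply: in_mnm_uniq => [|c]; rewrite mcoeffB !mcoeffX.
  by rewrite eqxx [b == a]eq_sym (negPf ne) subr0 oner_eq0.
have [-> _|_] := eqVneq a c; first exact: mo_refl.
by have [<- //|_] := eqVneq b c; rewrite subr0 eqxx.
Qed.

End InitialMonomial.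

(** * Frames of graded free complexes *)

(** The combinatorial skeleton of a free resolution of an ideal: basis elements
    with their level, their multidegree [fmu], and the basis element [fpr] that
    carries the largest term of their differential.  The element [fbot] spans
    level 0, the polynomial ring itself, and [fblk] filters the basis. *)
Record frame (N : nat) (le : rel 'X_{1..N}) := Frame {
  fbas :> finType;
  flt : rel fbas;
  flvl : fbas -> nat;
  fmu : fbas -> 'X_{1..N};
  fpr : fbas -> fbas;
  fblk : fbas -> nat;
  fbot : fbas;
  flt_irr : irreflexive flt;
  flt_trans : transitive flt;
  flt_total : forall c c', c != c' -> flt c c' || flt c' c;
  flvl_bot : flvl fbot = 0%N;
  flvl0 : forall c, flvl c = 0%N -> c = fbot;
  fmu_bot : fmu fbot = 0%MM;
  fpr_lvl : forall c, (0 < flvl c)%N -> flvl c = (flvl (fpr c)).+1;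
  fpr_mu : forall c, (0 < flvl c)%N -> (fmu (fpr c) <= fmu c)%MM;
  fpr_blk : forall c, (0 < flvl c)%N -> (fblk (fpr c) <= fblk c)%N
}.

Section Frames.
Variables (N : nat) (le : rel 'X_{1..N}) (F : frame le).
Local Notation term := ('X_{1..N} * F)%type.
Implicit Types (c : F) (v : 'X_{1..N}) (x y z : term).

(** Among the terms of value [v] and of the level of [c], passing to the largest
    term of the differential preserves strict inequalities with [c].  If [c] is
    the largest term of a vector f, then the term it produces in the differential
    of f cannot cancel, and f is not a cycle. *)
Definition upper v c := forall c', flvl c' = flvl c -> (fmu c' <= v)%MM ->
  flt c' c -> flt (fpr c') (fpr c).

(** Every term that is not upper is the largest term of the differential of an
    upper one.  The second condition says that the largest term prescribed for the
    differential of a basis element is one that a cycle may have. *)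
Definition schreyer_frame :=
  (forall v c, (0 < flvl c)%N -> (fmu c <= v)%MM -> upper v c \/
     exists c', [/\ fpr c' = c, flvl c' = (flvl c).+1, (fmu c' <= v)%MM,
                    (fblk c' <= fblk c)%N & upper v c'])
  /\ (forall c, (1 < flvl c)%N -> ~ upper (fmu c) (fpr c)).

Definition tlt x y := if x.1 == y.1 then flt x.2 y.2 else le x.1 y.1.
Definition tle x y := (x == y) || tlt x y.

Hypothesis hle : monomial_order le.

Lemma tlt_irr x : tlt x x = false.
Proof. by rewrite /tlt eqxx flt_irr. Qed.

Lemma tlt_le x y : tlt x y -> le x.1 y.1.
Proof. by rewrite /tlt; case: eqP => [->|//] _; apply: mo_refl. Qed.

Lemma tle_le x y : tle x y -> le x.1 y.1.
Proof. by case/orP => [/eqP ->|/tlt_le //]; apply: mo_refl. Qed.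

Lemma tlt_trans : transitive tlt.
Proof.
move=> y x z; rewrite /tlt; have [e1|n1] := eqVneq x.1 y.1.
  by rewrite e1; case: eqP => // _; apply: flt_trans.
have [<-|n2] := eqVneq y.1 z.1; first by rewrite (negPf n1).
have [e|_] := eqVneq x.1 z.1; last exact: mo_trans.
by rewrite -e => h1 h2; case/eqP: n1; apply: mo_anti h1 h2.
Qed.

Lemma tle_lt_trans x y z : tle x y -> tlt y z -> tlt x z.
Proof. by case/orP => [/eqP -> //|h]; apply: tlt_trans. Qed.

Lemma tle_trans : transitive tle.
Proof.
move=> y x z h /orP [/eqP <- //|h'].
by apply/orP; right; apply: tle_lt_trans h h'.
Qed.

Lemma tltNge x y : tlt x y = ~~ tle y x.
Proof.
apply/idP/idP => [h|].
  by apply/negP => /tle_lt_trans /(_ h); rewrite tlt_irr.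
rewrite /tle negb_or; case/andP => ne; rewrite /tlt.
rewrite [y.1 == _]eq_sym; have [e|n] := eqVneq x.1 y.1.
  move=> h; have : x.2 != y.2.
    apply: contraNneq ne => e2.
    by rewrite [y]surjective_pairing [x]surjective_pairing e e2.
  by move/flt_total => /orP [//|h']; rewrite h' in h.
move=> h.
by case/orP: (mo_total hle x.1 y.1) => // h'; rewrite h' in h.
Qed.

Lemma tle_total x y : tle x y || tle y x.
Proof.
by case h: (tle x y) => //=; move/negbT: h; rewrite -tltNge /tle => ->; rewrite orbT.
Qed.

Lemma tle_add a v1 c1 v2 c2 :
  tle ((a + v1)%MM, c1) ((a + v2)%MM, c2) = tle (v1, c1) (v2, c2).
Proof.
by rewrite /tle /tlt !xpair_eqE /= (mo_addl hle) !eqm_add2l.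
Qed.

(** Terms of degree less than [d] are finite in number, so this rank makes
    reductions of vectors of bounded degree terminate without an appeal to the
    well-foundedness of the monomial order. *)
Definition trank (d : nat) x : nat :=
  #|[pred z : 'X_{1..N < d} * F | tlt (bmnm z.1, z.2) x]|.

Lemma trank_lt d x y : (mdeg x.1 < d)%N -> tlt x y -> (trank d x < trank d y)%N.
Proof.
move=> hd h; apply: proper_card; apply/properP; split.
  by apply/subsetP => z; rewrite !inE => /tlt_trans; apply.
by exists (BMultinom hd, x.2); rewrite inE /= -surjective_pairing ?tlt_irr.
Qed.

Variable K : fieldType.
Local Notation S := {mpoly K[N]}.
Local Notation vec := (F -> S).
Implicit Types (f g w : vec) (D : F -> vec).

(** Coefficients are indexed by values: the term (v, c) stands for the monomial
    v / fmu c in front of the basis element c. *)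
Definition cof f x : K :=
  if (fmu x.2 <= x.1)%MM then (f x.2)@_(x.1 - fmu x.2) else 0.

Lemma cof_add f a c : cof f ((a + fmu c)%MM, c) = (f c)@_a.
Proof. by rewrite /cof /= lem_addl addmK. Qed.

Lemma cof_neq0 f x : cof f x != 0 ->
  (fmu x.2 <= x.1)%MM /\ (f x.2)@_(x.1 - fmu x.2) != 0.
Proof. by rewrite /cof; case: ifP; rewrite ?eqxx. Qed.

Definition dif D f : vec := fun c' => \sum_c f c * D c c'.

Definition bvec c : vec := fun c' => (c' == c)%:R.
Definition addmul f (q : S) g : vec := fun c => f c + q * g c.

Lemma dif_addmul D f q g c : dif D (addmul f q g) c = dif D f c + q * dif D g c.
Proof.
rewrite /dif mulr_sumr -big_split; apply: eq_bigr => c' _.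
by rewrite mulrDl mulrA.
Qed.

Lemma dif_bvec D c c' : dif D (bvec c) c' = D c c'.
Proof.
rewrite /dif (bigD1 c) //= /bvec eqxx mul1r big1 ?addr0 // => c1 /negPf ->.
by rewrite mul0r.
Qed.

Lemma cof_addmul f (l : K) a g x : cof (addmul f (l *: 'X_[a]) g) x =
  cof f x + l * (if (a <= x.1)%MM then cof g ((x.1 - a)%MM, x.2) else 0).
Proof.
rewrite /cof /addmul /=; case: ifP => h1; last first.
  rewrite add0r; case: ifP => h2; last by rewrite mulr0.
  rewrite ifN ?mulr0 //; apply: contraFN h1 => h1.
  by apply: lepm_trans h1 (lem_subr _ _).
rewrite mcoeffD -scalerAl mcoeffZ mcoeffXM; congr (_ + _ * _).
have [h2|h2] := boolP (a <= x.1)%MM; last first.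
  by case: ifP => // h3; case/negP: h2; apply: lepm_trans h3 (lem_subr _ _).
have -> : (a <= x.1 - fmu x.2)%MM = (fmu x.2 <= x.1 - a)%MM.
  apply/mnm_lepP/mnm_lepP => h i; move/(_ i): h; rewrite !mnmBE => h;
  move/mnm_lepP/(_ i): h1; move/mnm_lepP/(_ i): h2 => *; lia.
by case: ifP => // _; rewrite !submDA addmC.
Qed.

Lemma cof_bvec c x : cof (bvec c) x = (x == (fmu c, c))%:R.
Proof.
rewrite /cof /bvec; have [e|ne] := eqVneq x (fmu c, c).
  by rewrite e /= lepm_refl eqxx mcoeff1 submm eqxx.
case: ifP => // h; have [e|_] := eqVneq x.2 c; last by rewrite mcoeff0.
rewrite mcoeff1; case: eqP => // e'; case/eqP: ne.
by rewrite [x]surjective_pairing -[in LHS](submK h) e' add0m -e.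
Qed.

Lemma exists_lead f x : cof f x != 0 ->
  exists2 y, cof f y != 0 & forall z, cof f z != 0 -> tle z y.
Proof.
pose s := [seq (p.1 + fmu p.2, p.2)%MM | p <- [seq (a, c) | c <- enum F, a <- msupp (f c)]].
have hs z : (z \in s) = (cof f z != 0).
  apply/mapP/idP => [[p /allpairsPdep [c [a [_ ha ->]]] ->]|].
    by rewrite cof_add /= -mcoeff_msupp.
  case/cof_neq0 => h1 h2; exists ((z.1 - fmu z.2)%MM, z.2) => /=.
    by apply/allpairsPdep; exists z.2, (z.1 - fmu z.2)%MM; rewrite mem_enum mcoeff_msupp.
  by rewrite submK // -surjective_pairing.
rewrite -hs => hx.
suff [y ys hy] : exists2 y, y \in s & forall z, z \in s -> tle z y.
  by exists y; rewrite -?hs // => z; rewrite -hs; apply: hy.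
elim: s x hx {hs} => // y s IH x _.
case: s IH => [_|z s IH].
  by exists y; rewrite ?inE // => z; rewrite inE => /eqP ->; rewrite /tle eqxx.
have [t ts ht] := IH z (mem_head _ _).
have hyy : tle y y by rewrite /tle eqxx.
case/orP: (tle_total y t) => h.
  exists t; first by rewrite in_cons ts orbT.
  by move=> t'; rewrite in_cons => /orP [/eqP ->|/ht].
exists y; first exact: mem_head.
by move=> t'; rewrite in_cons => /orP [/eqP ->|/ht h'] //; apply: tle_trans h' h.
Qed.

End Frames.

(** * Construction of the differential on a frame *)

Section FrameResolution.
Variables (N : nat) (le : rel 'X_{1..N}) (hle : monomial_order le).
Variables (F : frame le) (hF : schreyer_frame F) (K : fieldType).
Local Notation S := {mpoly K[N]}.
Local Notation term := ('X_{1..N} * F)%type.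
Local Notation vec := (F -> S).
Implicit Types (c : F) (v : 'X_{1..N}) (x y z : term) (f g w : vec).
Implicit Types (D : F -> vec).

(** The conditions imposed on the differential of one basis element: it is
    homogeneous, respects levels and blocks, has its largest term where the frame
    prescribes it, and is a cycle. *)
Definition good D c :=
  [/\ forall x, cof (D c) x != 0 ->
        [/\ flvl c = (flvl x.2).+1, mdeg x.1 = mdeg (fmu c),
            (fblk x.2 <= fblk c)%N & tle x (fmu c, fpr c)],
      (0 < flvl c)%N -> cof (D c) (fmu c, fpr c) != 0
    & forall c', dif D (D c) c' = 0].

Lemma good_ext D D' c : D' c = D c ->
  (forall c', flvl c = (flvl c').+1 -> D' c' = D c') -> good D c -> good D' c.
Proof.
move=> e1 e2 [h1 h2 h3]; split; rewrite ?e1 // => c'.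
rewrite -[RHS](h3 c') /dif; apply: eq_bigr => c1 _.
have [->|nz] := eqVneq (D c c1) 0; first by rewrite !mul0r.
rewrite e2 //; have := h1 ((in_mnm le (D c c1) + fmu c1)%MM, c1).
by rewrite cof_add in_mnm_mem // => -[].
Qed.

(** The coefficient of the differential at (v, fpr c) receives the product of the
    leading coefficients and nothing else: any other contribution comes from a
    smaller term of [f], with the same value v, and upper terms forbid it. *)
Lemma dif_lead D l f x : (forall c, flvl c = l.+1 -> good D c) ->
  (forall z, cof f z != 0 -> flvl z.2 = l.+1 /\ tle z x) ->
  cof f x != 0 -> upper x.1 x.2 -> cof (dif D f) (x.1, fpr x.2) != 0.
Proof.
case: x => v c /= hD hf hx up.
have [hmu fx] := cof_neq0 hx; have [lvlc _] := hf _ hx; rewrite /= in hmu fx lvlc.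
have hpr : (fmu (fpr c) <= fmu c)%MM by apply: fpr_mu; rewrite lvlc.
have [h1 h2 _] := hD _ lvlc; rewrite lvlc /= in h1 h2.
have {h2} := cof_neq0 (h2 isT) => /= -[_ dx].
pose a := (v - fmu c)%MM; pose b := (fmu c - fmu (fpr c))%MM.
have eab : (a + b + fmu (fpr c) = v)%MM by rewrite -addmA !submK.
have key c1 a1 a2 : (f c1)@_a1 != 0 -> (D c1 (fpr c))@_a2 != 0 ->
    (a1 + a2 = a + b)%MM -> c1 = c /\ a1 = a.
  move=> fa da e; have t1 : cof f ((a1 + fmu c1)%MM, c1) != 0 by rewrite cof_add.
  have t2 : cof (D c1) ((a2 + fmu (fpr c))%MM, fpr c) != 0 by rewrite cof_add.
  have [l1 le1] := hf _ t1; have [g1 _ _] := hD _ l1; have [_ _ _ le2] := g1 _ t2.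
  have e1 : (a1 + fmu c1 = v)%MM.
    apply: (mo_anti hle (tle_le hle le1)).
    by rewrite -eab -e -addmA (mo_addl hle); apply: (tle_le hle le2).
  have e2 : (a2 + fmu (fpr c) = fmu c1)%MM.
    by apply: (@addmI _ a1); rewrite e1 addmA e.
  have [ec|nc] := eqVneq c1 c.
    by subst c1; split=> //; apply: (@addIm _ (fmu c)); rewrite e1 /a submK.
  have lt1 : flt c1 c.
    move: le1; rewrite e1 /tle /tlt /= xpair_eqE eqxx (negPf nc) /=.
    by [].
  have := up c1; rewrite l1 lvlc /= -e1 lem_addl => /(_ erefl isT lt1) lt2.
  move: le2; rewrite e2 /tle /tlt /= xpair_eqE eqxx /=.
  case/orP => [/eqP e3|lt3]; first by rewrite e3 flt_irr in lt2.
  by have := flt_trans lt2 lt3; rewrite flt_irr.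
rewrite -eab cof_add /dif raddf_sum /= (bigD1 c) //= big1 ?addr0.
  rewrite mcoeffM_uniq; first by rewrite mulf_neq0.
  by move=> a1 b1 h3 h4 h5; case: (key c a1 b1).
move=> c1 nc; apply/eqP/negPn/negP => /mcoeffM_ex [a1 [b1 [h3 h4 h5]]].
by case: (key c1 a1 b1) => // e; rewrite e eqxx in nc.
Qed.

Variables (G : nat -> S -> Prop) (phi : F -> S).

(** [G b] plays the part of the ideal generated by the [phi c] with c in blocks up
    to [b].  The third condition says that these [phi c] are a Groebner basis of it,
    and names a divisor of the initial monomial that is upper in the frame. *)
Definition generators :=
  [/\ forall b, G b 0,
      forall b c p q, flvl c = 1%N -> (fblk c <= b)%N -> G b p ->
        G b (p + q * phi c),
      forall b p, p != 0 -> G b p -> exists c,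
        [/\ flvl c = 1%N, (fblk c <= b)%N, (fmu c <= in_mnm le p)%MM
          & upper (in_mnm le p) c]
    & forall c, flvl c = 1%N -> [/\ phi c != 0, in_mnm le (phi c) = fmu c
        & forall a, (phi c)@_a != 0 -> mdeg a = mdeg (fmu c)]].

Hypothesis hG : generators.

Definition within l b (R : pred nat) f := forall x, cof f x != 0 ->
  [/\ flvl x.2 = l, (fblk x.2 <= b)%N & R (mdeg x.1)].

(** At level 0 every vector is a cycle, so membership in the ideal takes over. *)
Definition cycle_at D l b R f :=
  [/\ within l b R f, forall c, dif D f c = 0 & l = 0%N -> G b (f (fbot F))].

(** By [dif_lead] the largest term of a cycle is not upper, hence it is matched
    with an upper term of the next level; at level 0 the Groebner basis property
    provides the match. *)
Lemma cycle_lower D l b R f x : (forall c, flvl c = l -> good D c) ->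
  cycle_at D l b R f -> cof f x != 0 -> (forall z, cof f z != 0 -> tle z x) ->
  exists c, [/\ fpr c = x.2, flvl c = l.+1, (fmu c <= x.1)%MM,
                (fblk c <= b)%N & upper x.1 c].
Proof.
move=> hD [hw hz hg] hx hl; have [lx bx _] := hw _ hx.
case: l hD hw hg lx => [|l] hD hw hg lx.
  have [_ _ hgb _] := hG; have ex := flvl0 lx.
  move: x ex {lx bx} hx hl => [v c] /= ->; rewrite -[v]addm0 -(fmu_bot F) cof_add.
  move=> fv hl; have nz : f (fbot F) != 0 by apply: contraNneq fv => ->; rewrite mcoeff0.
  have ev : in_mnm le (f (fbot F)) = v.
    apply: (in_mnm_uniq hle) => // a fa.
    have := hl ((a + fmu (fbot F))%MM, fbot F); rewrite cof_add => /(_ fa).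
    by move/(tle_le hle) => /=; rewrite (mo_addr hle).
  have [c' [lc bc mc uc]] := hgb b _ nz (hg erefl).
  exists c'; rewrite ev in mc uc; rewrite fmu_bot addm0; split=> //.
  by apply: flvl0; have := fpr_lvl (c := c'); rewrite lc => /(_ isT) [].
have [hmu _] := cof_neq0 hx.
have lx0 : (0 < flvl x.2)%N by rewrite lx.
case: (hF.1 _ _ lx0 hmu) => [up|[c [e1 e2 e3 e4 e5]]].
  have /negP[] := dif_lead hD (fun z h => conj (let: And3 p _ _ := hw z h in p) (hl z h)) hx up.
  by rewrite /cof hz mcoeff0; case: ifP.
by exists c; split; rewrite ?e2 ?lx //; apply: leq_trans e4 bx.
Qed.

Lemma cof_shift_lead g c a x : cof g ((x.1 - a)%MM, x.2) != 0 -> (a <= x.1)%MM ->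
  (forall z, cof g z != 0 -> tle z (fmu c, fpr c)) -> tle x ((a + fmu c)%MM, fpr c).
Proof.
move=> h1 h2 h; have := h _ h1.
by rewrite -(tle_add hle a) [(a + (_ - _))%MM]addmC submK // -surjective_pairing.
Qed.

(** The division algorithm: the largest term of a cycle is cancelled by a multiple
    of the differential of the matching basis element, which leaves a smaller
    cycle.  All terms of the quotient are upper by construction, and this is used
    to control the largest term when the differential is extended. *)
Lemma cycle_boundary D l b (R : pred nat) f d : (forall c, (flvl c <= l.+1)%N -> good D c) ->
  (forall c, flvl c = 1%N -> D c (fbot F) = phi c) ->
  (forall n, R n -> (n < d)%N) -> cycle_at D l b R f ->
  exists w, [/\ within l.+1 b R w, forall x, cof w x != 0 -> upper x.1 x.2
              & forall c, dif D w c = f c].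
Proof.
move=> hD hphi hR; have [m] : exists m, forall x, cof f x != 0 -> (trank d x < m)%N.
  exists #|{: 'X_{1..N < d} * F}|.+1 => x _; rewrite ltnS /trank.
  exact: max_card.
elim: m f => [|m IH] f hm hf.
  exists (fun=> 0); split=> [x|x|c]; try by rewrite /cof mcoeff0 if_same eqxx.
  rewrite /dif big1 => [|c' _]; last by rewrite mul0r.
  apply/esym/eqP/negPn/negP => nz.
  by have := hm ((in_mnm le (f c) + fmu c)%MM, c); rewrite cof_add in_mnm_mem // => /(_ isT).
have [/existsP [c0 c0nz]|/existsPn hz] := boolP [exists c, f c != 0]; last first.
  apply: (IH f) => // x /cof_neq0 [_]; have := hz x.2.
  by rewrite negbK => /eqP ->; rewrite mcoeff0 eqxx.
have [x hx hl] : exists2 x, cof f x != 0 & forall z, cof f z != 0 -> tle z x.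
  apply: (@exists_lead _ _ _ hle _ f ((in_mnm le (f c0) + fmu c0)%MM, c0)).
  by rewrite cof_add in_mnm_mem.
have hDl c : flvl c = l -> good D c by move=> e; apply: hD; rewrite e.
have [c [pc lc mc bc uc]] := cycle_lower hDl hf hx hl.
have [g1 g2 g3] : good D c by apply: hD; rewrite lc.
rewrite lc /= pc in g2; have {}g2 := g2 isT.
pose a := (x.1 - fmu c)%MM; pose q := cof f x / cof (D c) (fmu c, x.2).
have eac : (a + fmu c = x.1)%MM by rewrite submK.
have [hw hz hg] := hf; have [_ _ Rx] := hw _ hx.
have dc y : (a <= y.1)%MM -> cof (D c) ((y.1 - a)%MM, y.2) != 0 ->
    [/\ flvl y.2 = l, (fblk y.2 <= b)%N, mdeg y.1 = mdeg x.1 & tle y x].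
  move=> h1 h2; have [l1 d1 b1 _] := g1 _ h2; rewrite /= in l1 d1 b1.
  rewrite lc in l1; case: l1 => <-; split=> //.
  - exact: leq_trans b1 bc.
  - by rewrite -(submK h1) mdegD d1 -mdegD addmC eac.
  - have := cof_shift_lead h2 h1 (fun z h => let: And4 _ _ _ p := g1 z h in p).
    by rewrite eac pc -surjective_pairing.
pose f1 := addmul f ((- q) *: 'X_[a]) (D c).
have f1P y : cof f1 y != 0 -> [/\ flvl y.2 = l, (fblk y.2 <= b)%N, R (mdeg y.1) & tlt y x].
  rewrite cof_addmul => h.
  have ne : y != x.
    apply: contraNneq h => ->; rewrite -eac lem_addr addmC addmK.
    by rewrite mulNr /q divfK // subrr.
  suff [h1 h2 h3] : [/\ flvl y.2 = l, (fblk y.2 <= b)%N & R (mdeg y.1) /\ tle y x].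
    by split=> //; case: h3 => // _ /orP [/eqP e|//]; rewrite e eqxx in ne.
  have [e0|fy] := eqVneq (cof f y) 0; last first.
    by have [? ? ?] := hw _ fy; split=> //; split=> //; apply: hl.
  move: h; rewrite e0 add0r mulf_eq0 negb_or => /andP [_].
  case: ifP; last by rewrite eqxx.
  by move=> h1 h2; have [? ? -> ?] := dc _ h1 h2.
have [w [w1 w2 w3]] : exists w, [/\ within l.+1 b R w,
    forall x, cof w x != 0 -> upper x.1 x.2 & forall c, dif D w c = f1 c].
  apply: IH.
    move=> y /f1P [_ _ Ry lty]; rewrite -ltnS; apply: leq_trans (hm _ hx).
    by rewrite ltnS; apply: trank_lt => //; apply: hR.
  split=> [y /f1P [] //|c'|l0]; first by rewrite dif_addmul hz g3 mulr0 addr0.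
  rewrite l0 in lc; rewrite /f1 /addmul hphi //.
  have [_ hgc _ _] := hG; apply: hgc => //; exact: hg.
exists (addmul w (q *: 'X_[a]) (bvec K c)).
have bP y : cof (addmul w (q *: 'X_[a]) (bvec K c)) y != 0 -> cof w y != 0 \/ y = (x.1, c).
  rewrite cof_addmul cof_bvec; case: ifP => h; last by rewrite mulr0 addr0; left.
  case: (_ =P (fmu c, c)) => [[e1 e2]|_]; last by rewrite mulr0 addr0; left.
  by right; rewrite -eac -e1 addmC submK // -e2 -surjective_pairing.
split=> [y /bP [/w1 //|->]|y /bP [/w2 //|-> //]|c'] //=.
by rewrite dif_addmul w3 dif_bvec /f1 /addmul scaleNr mulNr subrK.
Qed.

(** Level by level: the term prescribed for the differential of c has a boundary
    which is also the boundary of a vector [w] with upper terms, and the difference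
    is the required cycle.  Its largest term is the prescribed one, because a
    largest term coming from [w] would be upper. *)
Lemma frame_differential : exists D, (forall c, good D c)
  /\ (forall c, flvl c = 1%N -> D c (fbot F) = phi c).
Proof.
suff H : forall l, exists D, (forall c, (flvl c <= l.+1)%N -> good D c)
  /\ (forall c, flvl c = 1%N -> D c (fbot F) = phi c).
  case: (H (\max_(c : F) flvl c)%N) => D [h1 h2]; exists D; split=> // c.
  by apply: h1; apply: leqW; apply: (leq_bigmax (F := fun c => flvl c)).
elim=> [|l [D [hD hphi]]].
  pose D c : vec := fun c' => if (flvl c == 1%N) && (c' == fbot F) then phi c else 0.
  have DP c x : cof (D c) x != 0 -> [/\ flvl c = 1%N, x.2 = fbot F & (phi c)@_(x.1) != 0].
    case/cof_neq0; rewrite /D; case: ifP => [/andP [/eqP -> /eqP e]|]; last by rewrite mcoeff0 eqxx.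
    by rewrite e fmu_bot subm0.
  have [_ _ _ hphi] := hG.
  exists D; split=> [c|c e]; last by rewrite /D e !eqxx.
  move=> lc1; have prc : flvl c = 1%N -> fpr c = fbot F.
    by move=> e; apply: flvl0; have := fpr_lvl (c := c); rewrite e => /(_ isT) [].
  split=> [x /DP [e1 e2 h]|lc|c'].
  - have [nz e3 hd] := hphi _ e1; rewrite e2 flvl_bot; split=> //; first exact: hd.
      by rewrite -(prc e1); apply: fpr_blk; rewrite e1.
    rewrite prc // -e3 [x]surjective_pairing e2 /tle xpair_eqE eqxx andbT /tlt /=.
    by case: eqP => //= _; apply: in_mnm_max.
  - have {lc}lc : flvl c = 1%N by apply/eqP; rewrite eqn_leq lc1.
    have [nz e3 _] := hphi _ lc.
    by rewrite /cof prc //= fmu_bot lem0m subm0 /D lc !eqxx -e3 in_mnm_mem.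
  - rewrite /dif big1 // => c1 _; rewrite {1}/D; case: ifP; last by rewrite mul0r.
    by case/andP => _ /eqP ->; rewrite /D flvl_bot mulr0.
have /fin_all_exists [E hE] : forall c, exists g : vec, flvl c = l.+2 ->
    [/\ forall x, cof g x != 0 ->
          [/\ flvl c = (flvl x.2).+1, mdeg x.1 = mdeg (fmu c),
              (fblk x.2 <= fblk c)%N & tle x (fmu c, fpr c)],
        cof g (fmu c, fpr c) != 0
      & forall c', dif D g c' = 0].
  move=> c; have [lc|] := eqVneq (flvl c) l.+2; last by move=> /eqP h; exists (fun=> 0).
  have lc0 : (0 < flvl c)%N by rewrite lc.
  have lp : flvl (fpr c) = l.+1 by have := fpr_lvl lc0; rewrite lc => -[].
  have lp0 : (0 < flvl (fpr c))%N by rewrite lp.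
  have gp : good D (fpr c) by apply: hD; rewrite lp.
  have [p1 p2 p3] := gp.
  pose a := (fmu c - fmu (fpr c))%MM; pose R := pred1 (mdeg (fmu c)).
  have mp := fpr_mu lc0; have eac : (a + fmu (fpr c) = fmu c)%MM by rewrite submK.
  (* z is the monomial multiple of e_(fpr c) with the multidegree of c *)
  pose z := addmul (fun=> 0) (1 *: 'X_[a]) (bvec K (fpr c)).
  have zP x : cof z x = (x == (fmu c, fpr c))%:R.
    rewrite cof_addmul cof_bvec mul1r /cof mcoeff0 if_same add0r -eac.
    case: ifP => h; first congr (_ : bool)%:R; last first.
      by case: eqP => // e; rewrite e /= lem_addr in h.
    rewrite [x in RHS]surjective_pairing !xpair_eqE; congr (_ && _).
    by rewrite -[x.1 in RHS](submK h) [RHS]eq_sym addmC eqm_add2r eq_sym.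
  have dz c' : dif D z c' = 'X_[a] * D (fpr c) c'.
    rewrite dif_addmul dif_bvec scale1r /dif big1 ?add0r // => c1 _; exact: mul0r.
  have cyc : cycle_at D l (fblk c) R (dif D z).
    split=> [x|c'|l0].
    - have -> : cof (dif D z) x = cof (addmul (fun=> 0) (1 *: 'X_[a]) (D (fpr c))) x.
        by rewrite /cof dz /addmul add0r scale1r.
      rewrite cof_addmul mul1r {1}/cof mcoeff0 if_same add0r.
      case: ifP => [h|]; last by rewrite eqxx.
      move/p1 => /= [e1 e2 e3 _]; rewrite lp in e1; case: e1 => <-; split=> //.
        exact: leq_trans e3 (fpr_blk lc0).
      by rewrite /R /= -(submK h) mdegD e2 -mdegD addmC eac.
    - rewrite /dif (eq_bigr (fun c1 => 'X_[a] * (D (fpr c) c1 * D c1 c'))).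
        by rewrite -mulr_sumr; have := p3 c'; rewrite /dif => ->; rewrite mulr0.
      by move=> c1 _; rewrite mulrA -dz.
    - have [hg0 hgc _ _] := hG; rewrite dz hphi ?lp ?l0 // -[X in G _ X]add0r.
      by apply: hgc; rewrite ?lp ?l0 ?fpr_blk.
  have hR n : R n -> (n < (mdeg (fmu c)).+1)%N by move/eqP=> ->.
  have [w [w1 w2 w3]] := cycle_boundary hD hphi hR cyc.
  pose g := addmul z (- 1 *: 'X_[0%MM]) w.
  have gP x : cof g x = cof z x - cof w x.
    by rewrite cof_addmul lem0m subm0 -surjective_pairing mulN1r.
  have dg c' : dif D g c' = 0.
    by rewrite dif_addmul w3 mpolyX0 scaleN1r mulN1r subrr.
  have nup : cof w (fmu c, fpr c) = 0.
    apply/eqP/negPn/negP => /w2 /=; apply: hF.2; by rewrite lc.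
  have gz : cof g (fmu c, fpr c) != 0 by rewrite gP zP eqxx nup subr0 oner_eq0.
  have [x gx hx] := exists_lead hle gz.
  have gS y : cof g y != 0 -> y = (fmu c, fpr c) \/ cof w y != 0.
    rewrite gP zP; case: (y =P _) => [->|_]; first by left.
    by rewrite sub0r oppr_eq0; right.
  have gW y : cof g y != 0 -> [/\ flvl y.2 = l.+1, mdeg y.1 = mdeg (fmu c) & (fblk y.2 <= fblk c)%N].
    case/gS => [->|/w1 [? ? /eqP ?]]; split=> //=; exact: fpr_blk.
  have ex : x = (fmu c, fpr c).
    case: (gS _ gx) => // /w2 up.
    have hDl c' : flvl c' = l.+1 -> good D c' by move=> e; apply: hD; rewrite e.
    have /negP[] := dif_lead hDl (fun y h => conj (let: And3 p _ _ := gW y h in p) (hx y h)) gx up.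
    by rewrite /cof dg mcoeff0 if_same.
  exists g => _; split=> // y gy; have [e1 e2 e3] := gW _ gy.
  by rewrite e1 lc; split=> //; rewrite -ex; apply: hx.
pose D' c := if flvl c == l.+2 then E c else D c.
have e1 c : (flvl c <= l.+1)%N -> D' c = D c.
  by rewrite /D'; case: eqP => // ->; rewrite ltnn.
exists D'; split=> [c|c e]; last by rewrite e1 ?hphi // e.
rewrite leq_eqVlt => /orP [/eqP lc|lc]; last first.
  apply: (good_ext _ _ (hD _ lc)) => [|c' e]; first exact: e1.
  by apply: e1; rewrite -ltnS -e; apply: leqW.
have [h1 h2 h3] := hE _ lc; have e0 : D' c = E c by rewrite /D' lc eqxx.
split; rewrite e0 // => c'; rewrite -[RHS](h3 c') /dif; apply: eq_bigr => c1 _.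
have [->|nz] := eqVneq (E c c1) 0; first by rewrite !mul0r.
rewrite e1 //; have := h1 ((in_mnm le (E c c1) + fmu c1)%MM, c1).
by rewrite cof_add in_mnm_mem // lc => /(_ isT) [[<-]].
Qed.

End FrameResolution.

(** * The free resolution attached to a frame *)

Section MinimalResolution.
Variables (N : nat) (le : rel 'X_{1..N}) (hle : monomial_order le).
Variables (F : frame le) (hF : schreyer_frame F) (K : fieldType).
Local Notation S := {mpoly K[N]}.
Implicit Types (c : F) (f : F -> S).

(** Level 0 of the frame is the polynomial ring, the target of the augmentation,
    so the module of homological degree [i] is at level [i.+1]. *)
Definition flevel i : {set F} := [set c : F | flvl c == i.+1].
Definition fdeg i (k : 'I_#|flevel i|) : nat := mdeg (fmu (enum_val k)).

Variables (G : nat -> S -> Prop) (phi : F -> S) (hG : generators G phi).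
Variable D : F -> F -> S.
Hypotheses (hD : forall c, good D c)
  (hphi : forall c, flvl c = 1%N -> D c (fbot F) = phi c).

Lemma flevel_lvl i (k : 'I_#|flevel i|) : flvl (enum_val k) = i.+1.
Proof. by have := enum_valP k; rewrite inE => /eqP. Qed.

Lemma differential_coef c c' a : (D c c')@_a != 0 ->
  [/\ flvl c = (flvl c').+1, (mdeg a + mdeg (fmu c') = mdeg (fmu c))%N
    & (fblk c' <= fblk c)%N].
Proof.
rewrite -cof_add => h; have [g _ _] := hD c.
by have [e1 e2 e3 _] := g _ h; rewrite -mdegD.
Qed.

Lemma differential_neq0 c c' : D c c' != 0 -> flvl c = (flvl c').+1.
Proof. by move/(in_mnm_mem hle)/differential_coef => []. Qed.

(** Row vectors over one level, seen as vectors over the whole frame. *)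
Definition ext i (v : 'rV[S]_#|flevel i|) : F -> S :=
  fun c => \sum_(k | enum_val k == c) v 0 k.

Lemma ext_enum_val i (v : 'rV[S]_#|flevel i|) k : ext v (enum_val k) = v 0 k.
Proof.
by rewrite /ext (big_pred1 k) // => k'; rewrite (inj_eq enum_val_inj).
Qed.

Lemma ext_lvl i (v : 'rV[S]_#|flevel i|) c : ext v c != 0 -> flvl c = i.+1.
Proof.
rewrite /ext; have [/existsP [k /eqP <-] _|/existsPn h] :=
  boolP [exists k : 'I_#|flevel i|, enum_val k == c]; first exact: flevel_lvl.
by rewrite big1 ?eqxx // => k hk; have := h k; rewrite hk.
Qed.

Lemma dif_level i f c' : (forall c, f c != 0 -> flvl c = i.+1) ->
  dif D f c' = \sum_(k < #|flevel i|) f (enum_val k) * D (enum_val k) c'.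
Proof.
move=> h; have -> := esym (big_enum_val (A := [in flevel i]) (fun c => f c * D c c')).
rewrite /dif [RHS]big_mkcond; apply: eq_bigr => c _; rewrite inE.
case: eqP => // /eqP ne; apply/eqP; rewrite mulf_eq0; apply/orP; left.
by apply: contraNT ne => /h ->.
Qed.

Lemma dif_level_eq0 i f c' : (forall c, f c != 0 -> flvl c = i.+1) ->
  flvl c' != i -> dif D f c' = 0.
Proof.
move=> h ne; rewrite (dif_level _ h) big1 // => k _.
have [->|/differential_neq0] := eqVneq (D (enum_val k) c') 0; first by rewrite mulr0.
by rewrite flevel_lvl => -[e]; rewrite e eqxx in ne.
Qed.

Definition frame_diff i : 'M[S]_(#|flevel i.+1|, #|flevel i|) :=
  \matrix_(r, c) D (enum_val r) (enum_val c).
Definition frame_aug : 'cV[S]_#|flevel 0| := \col_r D (enum_val r) (fbot F).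

Variable T : nat.
Hypothesis hT : forall c, (fblk c <= T)%N.

(** The cycle need not be homogeneous: [cycle_boundary] applies with a bound on
    the degrees of its terms. *)
Lemma cycle_boundary_level l f :
  (forall c, f c != 0 -> flvl c = l) -> (forall c, dif D f c = 0) ->
  (l = 0%N -> G T (f (fbot F))) ->
  exists w : 'rV[S]_#|flevel l|,
    forall c, f c = \sum_k w 0 k * D (enum_val k) c.
Proof.
move=> hl hz hg.
pose d := \max_c (msize (f c) + mdeg (fmu c))%N.
have cyc : cycle_at G D l T [pred n | (n < d)%N] f.
  split=> // x /cof_neq0 [h1 h2]; split=> //.
    by apply: hl; apply: contraNneq h2 => ->; rewrite mcoeff0.
  apply: leq_trans (leq_bigmax (F := fun c => (msize (f c) + mdeg (fmu c))%N) x.2).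
  by rewrite -[in X in (X <= _)%N](submK h1) mdegD ltn_add2r msize_mdeg_lt // mcoeff_msupp.
have hD' c : (flvl c <= l.+1)%N -> good D c by move=> _; apply: hD.
have [w [w1 _ w3]] := cycle_boundary hle hF hG hD' hphi (fun n h => h) cyc.
exists (\row_k w (enum_val k)) => c; rewrite -w3 (dif_level (i := l)).
  by apply: eq_bigr => k _; rewrite mxE.
move=> c' /(in_mnm_mem hle); rewrite -cof_add => /w1 [] //.
Qed.

Lemma dif_ext i (v : 'rV[S]_#|flevel i|) c :
  dif D (ext v) c = \sum_k v 0 k * D (enum_val k) c.
Proof.
rewrite (dif_level (i := i)); last exact: ext_lvl.
by apply: eq_bigr => k _; rewrite ext_enum_val.
Qed.

Lemma dif_dif f c : dif D (dif D f) c = 0.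
Proof.
rewrite /dif; under eq_bigr do rewrite mulr_suml.
rewrite exchange_big big1 // => c1 _; have [_ _ h] := hD c1.
transitivity (f c1 * dif D (D c1) c); last by rewrite h mulr0.
rewrite /dif mulr_sumr.
by apply: eq_bigr => c2 _; rewrite mulrA.
Qed.

Lemma level_exact i (v : 'rV[S]_#|flevel i|) :
  (forall c, dif D (ext v) c = 0) <->
  exists w : 'rV[S]_#|flevel i.+1|, v = w *m frame_diff i.
Proof.
split=> [hv|[w ->] c].
  have [|w hw] := cycle_boundary_level (@ext_lvl i v) hv; first by [].
  exists w; apply/rowP => k; rewrite -ext_enum_val hw mxE.
  by apply: eq_bigr => r _; rewrite mxE.
rewrite -[RHS](dif_dif (ext w) c) !(dif_level (i := i)).
- by apply: eq_bigr => k _; rewrite ext_enum_val mxE dif_ext; congr (_ * _);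
    apply: eq_bigr => r _; rewrite mxE.
- move=> c' ne; apply/eqP; apply: contraNT ne => ne; apply/eqP.
  by apply: (@dif_level_eq0 i.+1) ne; apply: ext_lvl.
- exact: ext_lvl.
Qed.

Lemma frame_graded_resolution :
  graded_resolution (G T) (FreeComplex (@fdeg) frame_diff frame_aug).
Proof.
split=> /=.
- split=> [i|] r c t; rewrite mcoeff_msupp mxE => /differential_coef [_ e _] //.
  by rewrite /fdeg -e fmu_bot mdeg0.
- move=> p; split=> [hp|[v ->]].
    pose f : F -> S := fun c => if c == fbot F then p else 0.
    have hf c : f c != 0 -> flvl c = 0%N.
      by rewrite /f; case: (c =P _) => [-> _|_]; rewrite ?flvl_bot ?eqxx.
    have hz c : dif D f c = 0.
      rewrite /dif big1 // => c' _; have [->|/hf h] := eqVneq (f c') 0.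
        by rewrite mul0r.
      have [->|/differential_neq0] := eqVneq (D c' c) 0; first by rewrite mulr0.
      by rewrite h.
    have [|w hw] := cycle_boundary_level hf hz; first by rewrite /f eqxx.
    exists w; have := hw (fbot F); rewrite /f eqxx => ->; rewrite mxE.
    by apply: eq_bigr => k _; rewrite mxE.
  have [h0 hc _ _] := hG; rewrite mxE; elim/big_rec: _ => // k q _ hq.
  by rewrite addrC mxE hphi ?flevel_lvl //; apply: hc; rewrite ?flevel_lvl.
- move=> v; rewrite -level_exact; split=> [h c|h].
    have [e|ne] := eqVneq (flvl c) 0%N.
      transitivity ((v *m frame_aug) 0 0); last by rewrite h mxE.
      by rewrite dif_ext (flvl0 e) mxE; apply: eq_bigr => k _; rewrite mxE.
    by apply: (@dif_level_eq0 0) ne; apply: ext_lvl.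
  apply/matrixP => a b; rewrite !ord1 [LHS]mxE [RHS]mxE -[RHS](h (fbot F)).
  by rewrite dif_ext; apply: eq_bigr => k _; rewrite mxE.
move=> i v; rewrite -level_exact; split=> [h c|h].
  have [e|ne] := eqVneq (flvl c) i.+1.
    have hc : c \in flevel i by rewrite inE e.
    rewrite -[c](enum_rankK_in hc hc) dif_ext.
    transitivity ((v *m frame_diff i) 0 (enum_rank_in hc c)).
      by rewrite mxE; apply: eq_bigr => k _; rewrite mxE.
    by rewrite h mxE.
  by apply: (@dif_level_eq0 i.+1) ne; apply: ext_lvl.
apply/rowP => k; rewrite [LHS]mxE [RHS]mxE -[RHS](h (enum_val k)) dif_ext.
by apply: eq_bigr => r _; rewrite mxE.
Qed.

End MinimalResolution.

(** A nonzero constant entry of the differential joins two basis elements of equal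
    degree, consecutive levels and non-increasing blocks; excluding such pairs makes
    the resolution minimal. *)
Lemma frame_minimal_resolution (N : nat) (le : rel 'X_{1..N})
    (hle : monomial_order le) (F : frame le) (hF : schreyer_frame F)
    (K : fieldType) (G : nat -> {mpoly K[N]} -> Prop) (phi : F -> {mpoly K[N]})
    (T : nat) :
  generators G phi -> (forall c : F, (fblk c <= T)%N) ->
  (forall c c' : F, (0 < flvl c')%N -> flvl c = (flvl c').+1 ->
     (fblk c' <= fblk c)%N -> mdeg (fmu c) <> mdeg (fmu c')) ->
  exists d a, let C := FreeComplex (@fdeg N le F) d a in
    graded_resolution (G T) C /\ forall i, @diffK K N C i = 0.
Proof.
move=> hG hT hmin; have [D [hD hphi]] := frame_differential hle hF hG.
exists (frame_diff D), (frame_aug D); split; first exact: (frame_graded_resolution hle hF hG hD hphi hT).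
move=> i; apply/matrixP => r c; rewrite !mxE /=; apply/eqP/negPn/negP.
move/(differential_coef hD) => [e1 e2 e3].
have lc := flevel_lvl c.
by apply: (hmin _ _ _ e1 e3); rewrite ?lc // -e2 mdeg0.
Qed.

Lemma tor_dim_minimal (K : fieldType) (N : nat) (C : free_complex K N) i j :
  (forall i, diffK C i = 0) -> tor_dim C i j = \rank (degree_part C i j).
Proof.
move=> h; rewrite /tor_dim h cap0mx mxrank0 subn0.
have e : (cycles C i :=: 1%:M)%MS by case: i => [|i] //=; rewrite h; apply: kermx0.
by rewrite (cap_eqmx e (eqmx_refl _)) cap1mx.
Qed.

(** * Independence of Tor from the resolution *)

Section Comparison.
Variables (K : fieldType) (N : nat).
Local Notation S := {mpoly K[N]}.
Local Notation complex := (free_complex K N).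
Implicit Types C : complex.

Lemma mcoeff_pihomog d (p : S) m :
  (pihomog mdeg d p)@_m = if mdeg m == d then p@_m else 0.
Proof.
rewrite pihomogE raddf_sum /= -big_filter.
have E k : (p@_k *: 'X_[k])@_m = if k == m then p@_m else 0.
  by rewrite mcoeffZ mcoeffX; case: eqP => [->|_]; rewrite ?mulr1 ?mulr0.
rewrite (eq_bigr _ (fun k _ => E k)) -big_mkcond /= -big_filter.
case: ifP => hd; last first.
  rewrite big_seq_cond big1 // => k; rewrite andbT mem_filter => /andP [/eqP ->].
  by rewrite mem_filter hd.
have [hm|hm] := boolP (m \in msupp p).
  rewrite filter_pred1_uniq ?big_seq1 ?filter_uniq ?msupp_uniq //.
  by rewrite mem_filter hd.
rewrite (memN_msupp_eq0 hm) big1 //.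
Qed.

(** The augmented complex, shifted by one so that the augmentation becomes the
    differential of index 0 and needs no separate treatment. *)
Definition lrk C i : nat := if i is i'.+1 then rk C i' else 1%N.
Definition ldeg C i : 'I_(lrk C i) -> nat :=
  if i is i'.+1 then @gdeg K N C i' else fun=> 0%N.
Definition ldiff C i : 'M[S]_(lrk C i.+1, lrk C i) :=
  if i is i'.+1 then diff C i' else aug C.

Lemma graded_coef a b (da : 'I_a -> nat) (db : 'I_b -> nat) (D : 'M[S]_(a, b)) r c t :
  graded_mx da db D -> (D r c)@_t != 0 -> (mdeg t + db c = da r)%N.
Proof. by move=> h; rewrite -mcoeff_msupp => /h. Qed.

Lemma graded_mul a b c (da : 'I_a -> nat) (db : 'I_b -> nat) (dc : 'I_c -> nat)
    (A : 'M[S]_(a, b)) (B : 'M[S]_(b, c)) :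
  graded_mx da db A -> graded_mx db dc B -> graded_mx da dc (A *m B).
Proof.
move=> hA hB r s t; rewrite mcoeff_msupp mxE => /mcoeff_sum_ex [k].
case/mcoeffM_ex => [a1 [b1 [<- /(graded_coef hA) <- /(graded_coef hB) <-]]].
by rewrite mdegD addnA.
Qed.

Section Resolution.
Variables (I : S -> Prop) (C : complex) (hC : graded_resolution I C).

Lemma ldiff_graded i : graded_mx (@ldeg C i.+1) (@ldeg C i) (ldiff C i).
Proof. by have [[h1 h2] _ _ _] := hC; case: i => [|i]; [apply: h2 | apply: h1]. Qed.

Lemma ldiff_exact i (v : 'rV_(lrk C i.+1)) :
  v *m ldiff C i = 0 <-> exists w : 'rV_(lrk C i.+2), v = w *m ldiff C i.+1.
Proof. by have [_ _ h1 h2] := hC; case: i v => [|i] v; [apply: h1 | apply: h2]. Qed.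

Lemma ldiff_comp i : ldiff C i.+1 *m ldiff C i = 0.
Proof.
apply/row_matrixP => r; rewrite row0 row_mul.
by apply/ldiff_exact; exists (delta_mx 0 r); rewrite rowE.
Qed.

Lemma mx_of_rows a b c (A : 'M[S]_(a, b)) (B : 'M[S]_(c, b)) (P : 'I_a -> 'rV[S]_c -> Prop) :
  (forall r, exists2 w, P r w & row r A = w *m B) ->
  exists2 X : 'M_(a, c), forall r, P r (row r X) & A = X *m B.
Proof.
move=> h; have /fin_all_exists2 [w hw ew] := h.
exists (\matrix_r w r) => [r|]; first by rewrite rowK.
by apply/row_matrixP => r; rewrite row_mul rowK.
Qed.

(** Discarding from [w] the terms of the wrong degree does not change the part of
    degree [e] of its image, since the differential is homogeneous. *)
Lemma homogeneous_lift i e (v : 'rV[S]_(lrk C i)) :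
  (forall c t, (v 0 c)@_t != 0 -> (mdeg t + ldeg c = e)%N) ->
  (exists w, v = w *m ldiff C i) ->
  exists2 w : 'rV[S]_(lrk C i.+1),
    forall c t, (w 0 c)@_t != 0 -> (mdeg t + ldeg c = e)%N & v = w *m ldiff C i.
Proof.
move=> hv [w ew].
pose w' : 'rV[S]_(lrk C i.+1) :=
  \row_c if (ldeg c <= e)%N then pihomog mdeg (e - ldeg c) (w 0 c) else 0.
have hw' c t : (w' 0 c)@_t = if (mdeg t + ldeg c == e)%N then (w 0 c)@_t else 0.
  rewrite mxE; case: (leqP (ldeg c) e) => h.
    rewrite mcoeff_pihomog; congr (if _ then _ else _).
    by apply/eqP/eqP => h'; lia.
  by rewrite mcoeff0 ifN //; apply/eqP => h'; lia.
exists w' => [c t|]; first by rewrite hw'; case: (_ =P e) => //; rewrite eqxx.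
apply/rowP => c; apply/mpolyP => t.
have [ht|ht] := eqVneq (mdeg t + ldeg c)%N e.
  rewrite ew !mxE !raddf_sum /=; apply: eq_bigr => k _.
  apply/eqP; rewrite -subr_eq0 -mcoeffB -mulrBl; apply/negPn/negP.
  case/mcoeffM_ex => [a [b [e1 wa /(graded_coef (ldiff_graded (i := i))) e2]]].
  move: wa.
  have ek : (mdeg a + @ldeg C i.+1 k = e)%N by rewrite -ht -e1 mdegD -addnA e2.
  by rewrite mcoeffB hw' ek eqxx subrr eqxx.
transitivity (0 : K).
  by apply/eqP/negPn/negP => /hv h; case/eqP: ht.
apply/esym/eqP/negPn/negP; rewrite mxE => /mcoeff_sum_ex [k].
case/mcoeffM_ex => [a [b [e1 wa /(graded_coef (ldiff_graded (i := i))) e2]]].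
move: wa; rewrite hw'; case: (_ =P e) => [e3 _|_]; last by rewrite eqxx.
by case/eqP: ht; rewrite -e1 mdegD -addnA e2.
Qed.

Lemma graded_lift i a (da : 'I_a -> nat) (X : 'M[S]_(a, lrk C i)) :
  graded_mx da (@ldeg C i) X ->
  (forall r, exists w, row r X = w *m ldiff C i) ->
  exists2 Y, graded_mx da (@ldeg C i.+1) Y & X = Y *m ldiff C i.
Proof.
move=> hX hr.
have [r|Y hY eY] := @mx_of_rows _ _ _ X (ldiff C i)
   (fun r w => forall c t, (w 0 c)@_t != 0 -> (mdeg t + ldeg c = da r)%N).
  apply: homogeneous_lift; last exact: hr.
  by move=> c t; rewrite mxE => /(graded_coef hX).
exists Y => // r c t; rewrite mcoeff_msupp => h; apply: hY; by rewrite mxE.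
Qed.

Lemma kernel_lift i a (X : 'M[S]_(a, lrk C i.+1)) : X *m ldiff C i = 0 ->
  exists Y, X = Y *m ldiff C i.+1.
Proof.
move=> h; have [r|Y _ ->] := @mx_of_rows _ _ _ X (ldiff C i.+1) (fun _ _ => True).
  have [w ->] : exists w, row r X = w *m ldiff C i.+1; last by exists w.
  by apply/ldiff_exact; rewrite -row_mul h row0.
by exists Y.
Qed.

End Resolution.

(** The comparison theorem.  The maps are built by recursion on [i]; the invariant
    is that the rows of the composite with the differential are boundaries, so that
    the next map exists. *)
Lemma chain_map (I : S -> Prop) C C' : graded_resolution I C -> graded_resolution I C' ->
  exists f : forall i, 'M[S]_(lrk C i, lrk C' i),
    [/\ f 0%N = 1%:M, forall i, graded_mx (@ldeg C i) (@ldeg C' i) (f i)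
      & forall i, f i.+1 *m ldiff C' i = ldiff C i *m f i].
Proof.
move=> hC hC'.
pose P i (f : 'M[S]_(lrk C i, lrk C' i)) := graded_mx (@ldeg C i) (@ldeg C' i) f
  /\ forall r, exists w, row r (ldiff C i *m f) = w *m ldiff C' i.
have step i (f : {f | P i f}) : {f' : {f | P i.+1 f} | 
    sval f' *m ldiff C' i = ldiff C i *m sval f}.
  apply: constructive_indefinite_description; case: f => f [gf hf] /=.
  have gX := graded_mul (ldiff_graded hC (i := i)) gf.
  have [Y gY eY] := graded_lift hC' gX hf.
  have PY : P i.+1 Y.
    split=> // r; apply/(ldiff_exact hC').
    by rewrite -row_mul -mulmxA -eY mulmxA (ldiff_comp hC) mul0mx row0.
  by exists (exist _ Y PY).
have P0 : P 0%N 1%:M.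
  split=> [r c t|r].
    by rewrite !ord1 mxE mcoeff_msupp mcoeff1 /=; case: (t =P _) => [->|_]; rewrite ?mdeg0 ?eqxx.
  rewrite mulmx1; have [_ hI _ _] := hC; have [_ hI' _ _] := hC'.
  have : I (aug C r 0).
    apply/hI; exists (delta_mx 0 r); by rewrite -rowE mxE.
  case/hI' => v ev; exists v; apply/rowP => c; rewrite !ord1 -ev mxE.
  by [].
pose f := fix f i : {f | P i f} :=
  if i is i'.+1 then sval (step i' (f i')) else exist _ _ P0.
exists (fun i => sval (f i)); split=> // i; first by case: (f i) => ? [].
exact: (svalP (step i (f i))).
Qed.

(** Only the homotopy near index [i] is kept.  At the start it vanishes, which
    matters because the augmentation is not part of the complex that computes
    Tor. *)
Lemma null_homotopy (I : S -> Prop) C (phi : forall i, 'M[S]_(lrk C i)) i :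
  graded_resolution I C -> phi 0%N = 0 ->
  (forall i, phi i.+1 *m ldiff C i = ldiff C i *m phi i) ->
  exists h h', phi i.+1 = h *m ldiff C i.+1 + ldiff C i *m h' /\ (i = 0%N -> h' = 0).
Proof.
move=> hC h0 hphi; elim: i => [|i [h [h' [e _]]]].
  have [|h e] := kernel_lift hC (i := 0) (X := phi 1%N); first by rewrite hphi h0 mulmx0.
  by exists h, 0; rewrite mulmx0 addr0.
have [|h1 e1] := kernel_lift hC (i := i.+1) (X := phi i.+2 - ldiff C i.+1 *m h).
  by rewrite mulmxBl hphi e mulmxDr !mulmxA (ldiff_comp hC) mul0mx addr0 subrr.
by exists h1, h; rewrite -e1 subrK.
Qed.

(** A linear map with a left inverse up to boundaries is injective on homology:
    Z / B embeds in Z' / B', here through the composite of [f] with the quotient map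
    by B'. *)
Lemma mxrank_homology_le n n' m m' p p' (Z : 'M[K]_(m, n)) (B : 'M[K]_(p, n))
    (Z' : 'M[K]_(m', n')) (B' : 'M[K]_(p', n')) (f : 'M[K]_(n, n')) (g : 'M[K]_(n', n)) :
  (B' <= Z')%MS -> (Z *m f <= Z')%MS -> (B' *m g <= B)%MS ->
  (Z *m f *m g - Z <= B)%MS -> (\rank Z - \rank B <= \rank Z' - \rank B')%N.
Proof.
move=> hB hf hg hfg; pose q := f *m cokermx B'.
have h1 : (Z :&: kermx q <= B)%MS.
  apply/rV_subP => v; rewrite sub_capmx => /andP [/submxP [x ->] /sub_kermxP e].
  have hv : (x *m Z *m f <= B')%MS by rewrite submxE -mulmxA -/q e.
  have hv2 := submx_trans (submxMr g hv) hg.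
  have := submx_trans (submxMl x _) hfg; rewrite mulmxBr !mulmxA => hv3.
  have -> : x *m Z = x *m Z *m f *m g - (x *m Z *m f *m g - x *m Z).
    by rewrite opprB addrC subrK.
  by rewrite addmx_sub ?eqmx_opp.
have h2 : (Z *m q <= Z' *m cokermx B')%MS by rewrite /q mulmxA submxMr.
have h3 : (B' <= Z' :&: kermx (cokermx B'))%MS.
  by rewrite sub_capmx hB; apply/sub_kermxP/mulmx_coker.
have := mxrank_mul_ker Z q; have := mxrank_mul_ker Z' (cokermx B').
have := mxrankS h1; have := mxrankS h2; have := mxrankS h3; lia.
Qed.

Local Notation mc0 := (map_mx (mcoeff (0%MM : 'X_{1..N}) : S -> K)).

Definition deg_mx n (d : 'I_n -> nat) j : 'M[K]_n := diag_mx (\row_c (d c == j)%:R).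

Lemma graded_deg_mx a b (da : 'I_a -> nat) (db : 'I_b -> nat) (f : 'M[S]_(a, b)) j :
  graded_mx da db f -> deg_mx da j *m mc0 f = mc0 f *m deg_mx db j.
Proof.
move=> hf; apply/matrixP => r c; rewrite mul_diag_mx mul_mx_diag !mxE.
have [->|/(graded_coef hf)] := eqVneq (f r c)@_0 0; first by rewrite mul0r mulr0.
by rewrite mdeg0 add0n => ->; rewrite mulrC.
Qed.

(** Reduced modulo the variables, comparison maps in both directions are inverse
    to each other on homology, by the null homotopy of their composite minus the
    identity. *)
Lemma tor_dim_le (I : S -> Prop) C C' i j :
  graded_resolution I C -> graded_resolution I C' -> (tor_dim C i j <= tor_dim C' i j)%N.
Proof.
move=> hC hC'; have [f [f0 gf cf]] := chain_map hC hC'.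
have [g [g0 gg cg]] := chain_map hC' hC.
pose phi k := f k *m g k - 1%:M.
have phi0 : phi 0%N = 0 by rewrite /phi f0 g0 mulmx1 subrr.
have cphi k : phi k.+1 *m ldiff C k = ldiff C k *m phi k.
  by rewrite /phi mulmxBl mulmxBr mul1mx mulmx1 -mulmxA cg !mulmxA cf.
have [h [h' [eh h'0]]] := null_homotopy i hC phi0 cphi.
have dd (X : complex) (hX : graded_resolution I X) : (diffK X i <= cycles X i)%MS.
  case: i {eh h h'0 h'} => [|i] /=; first exact: submx1.
  apply/sub_kermxP; rewrite -map_mxM; have := ldiff_comp hX i.+1.
  by rewrite /= => ->; rewrite map_mx0.
have gsub (X Y : complex) (k : 'M[S]_(rk X i, rk Y i)) n (v : 'M[K]_(n, rk X i)) :
    graded_mx (@gdeg K N X i) (@gdeg K N Y i) k -> (v <= degree_part X i j)%MS ->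
    (v *m mc0 k <= degree_part Y i j)%MS.
  move=> hk /submxP [w ->]; rewrite -mulmxA [degree_part _ _ _ *m _](graded_deg_mx _ hk).
  by rewrite mulmxA submxMl.
have csub n (v : 'M[K]_(n, rk C i)) : (v <= cycles C i)%MS -> v *m mc0 (ldiff C i *m h') = 0.
  case: i h' h'0 v {eh h gsub dd} => [|i] h' h'0 v /=.
    by rewrite h'0 // mulmx0 map_mx0 mulmx0.
  by move/sub_kermxP => e; rewrite map_mxM mulmxA [X in X *m _]e mul0mx.
apply: (@mxrank_homology_le _ _ _ _ _ _ _ _ _ _ (mc0 (f i.+1)) (mc0 (g i.+1))).
- by rewrite sub_capmx capmxSr andbT; apply: submx_trans (capmxSl _ _) (dd _ hC').
- rewrite sub_capmx; apply/andP; split; last by apply: gsub (gf i.+1) (capmxSr _ _).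
  have := capmxSl (cycles C i) (degree_part C i j).
  move: (cycles C i :&: _)%MS => A hA.
  case: i {eh h h' h'0 csub gsub dd} A hA => [|i] A hA /=; first exact: submx1.
  apply/sub_kermxP; rewrite -mulmxA -map_mxM.
  have := cf i.+1; rewrite /= => ->; rewrite map_mxM mulmxA.
  by move/sub_kermxP: hA => ->; rewrite mul0mx.
- rewrite sub_capmx; apply/andP; split; last by apply: gsub (gg i.+1) (capmxSr _ _).
  apply: submx_trans (submxMr _ (capmxSl _ _)) _; rewrite -map_mxM.
  by have := cg i.+1; rewrite /= => <-; rewrite map_mxM submxMl.
set A := (_ :&: _)%MS; have hA : (A <= degree_part C i j)%MS by exact: capmxSr.
have hA' : (A <= cycles C i)%MS by exact: capmxSl.
have -> : A *m mc0 (f i.+1) *m mc0 (g i.+1) - A = A *m mc0 (phi i.+1).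
  by rewrite -mulmxA -map_mxM /phi map_mxB map_mx1 mulmxBr mulmx1.
rewrite sub_capmx; apply/andP; split.
  rewrite eh map_mxD mulmxDr csub // addr0 map_mxM mulmxA; exact: submxMl.
rewrite /phi map_mxB map_mx1 mulmxBr mulmx1 addmx_sub ?eqmx_opp //.
exact: gsub (graded_mul (gf i.+1) (gg i.+1)) hA.
Qed.

Lemma betti_resolution (I : S -> Prop) C i j :
  graded_resolution I C -> betti I i j = tor_dim C i j.
Proof.
move=> hC; have : exists b, exists2 F, graded_resolution I F & b = tor_dim F i j.
  by exists (tor_dim C i j), C.
move/(epsilon_spec (inhabits 0%N)) => [F hF]; rewrite -/(betti I i j) => ->.
by apply/eqP; rewrite eqn_leq !(@tor_dim_le I).
Qed.

End Comparison.

(** * Kernels of monomial maps *)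

Section MonomialMap.
Variables (K : fieldType) (n m : nat) (w : 'I_n -> 'X_{1..m}).

Definition wexp (u : 'X_{1..n}) : 'X_{1..m} := (\sum_i w i *+ u i)%MM.

Definition wmap (p : {mpoly K[n]}) : {mpoly K[m]} :=
  mmap (@mpolyC m K) (fun i => 'X_[w i]) p.

Lemma wexpE u j : wexp u j = (\sum_i w i j * u i)%N.
Proof. by rewrite /wexp mnm_sumE; apply: eq_bigr => i _; rewrite mulmnE. Qed.

Lemma mmap1_wexp u : mmap1 (fun i => 'X_[w i] : {mpoly K[m]}) u = 'X_[wexp u].
Proof.
rewrite /mmap1 /wexp.
rewrite (big_morph (fun a => 'X_[K, a]) (@mpolyXD m K) (@mpolyX0 m K)).
by apply: eq_bigr => i _; rewrite mpolyXn.
Qed.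

Lemma wmapX u : wmap 'X_[u] = 'X_[wexp u].
Proof. by rewrite /wmap mmapX mmap1_wexp. Qed.

Lemma wmap_binomial u v : wmap ('X_[u] - 'X_[v]) = 0 <-> wexp u = wexp v.
Proof.
rewrite /wmap mmapB -!/(wmap _) !wmapX; split=> [/eqP|->]; last by rewrite subrr.
rewrite subr_eq0 => /eqP /(congr1 (mcoeff (wexp u))); rewrite !mcoeffX eqxx.
by case: eqP => [->|_ /eqP] //; rewrite oner_eq0.
Qed.

Lemma wmap_ideal p q r : wmap p = 0 -> wmap r = 0 -> wmap (p + q * r) = 0.
Proof.
move=> hp hr; rewrite /wmap mmapD -!/(wmap _) hp add0r.
rewrite /wmap rmorphM /=; first by rewrite -/(wmap r) hr mulr0.
Qed.

(** The coefficients of [p] over the monomials with a given image add up to 0, so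
    no monomial of [p] is alone above its image. *)
Lemma wmap_ker_support p v : wmap p = 0 -> p@_v != 0 ->
  exists v', [/\ v' != v, p@_v' != 0 & wexp v' = wexp v].
Proof.
move=> hp pv; have vS : v \in msupp p by rewrite mcoeff_msupp.
have [/hasP [v' h1 /andP [h2 /eqP h3]]|/hasPn h] :=
  boolP (has (fun v' => (v' != v) && (wexp v' == wexp v)) (msupp p)).
  by exists v'; rewrite -mcoeff_msupp.
case/eqP: pv; have := congr1 (mcoeff (wexp v)) hp.
rewrite /wmap /mmap raddf_sum mcoeff0 /= (bigD1_seq v) ?msupp_uniq //=.
rewrite mmap1_wexp mcoeffCM mcoeffX eqxx mulr1 big_seq_cond big1 ?addr0 //.
move=> v' /andP [h1 h2]; rewrite mmap1_wexp mcoeffCM mcoeffX.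
by have := h _ h1; rewrite h2 /= => /negPf ->; rewrite mulr0.
Qed.

End MonomialMap.

(** * Primitive binomials and alternating walks *)

Section Graver.
Variables (K : fieldType) (V : finType) (G : sgraph V).
Local Notation E := #|edges G|.
Implicit Types (u v : 'X_{1..E}) (x y z : V).

Definition vdeg u x : nat := \sum_(i : 'I_E | x \in enum_val i) u i.

Lemma edgeP (e : {set V}) :
  reflect (exists x y, adj G x y /\ e = [set x; y]) (e \in edges G).
Proof.
rewrite inE; apply: (iffP existsP) => [[x /existsP [y /andP [h /eqP ->]]]|[x [y [h ->]]]].
  by exists x, y.
by exists x; apply/existsP; exists y; rewrite h eqxx.
Qed.

Lemma adj_neq x y : adj G x y -> x != y.
Proof. by apply: contraTneq => ->; rewrite adj_irrefl. Qed.

Lemma edge_other (i : 'I_E) x : x \in enum_val i ->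
  exists2 y, adj G x y & enum_val i = [set x; y].
Proof.
have /edgeP [a [b [h ->]]] := enum_valP i.
rewrite !inE => /orP [] /eqP ->; first by exists b.
by exists a; rewrite ?[adj G b a]adj_sym // setUC.
Qed.

Lemma vdegD u v x : vdeg (u + v) x = (vdeg u x + vdeg v x)%N.
Proof. by rewrite /vdeg -big_split; apply: eq_bigr => i _; rewrite mnmDE. Qed.

Lemma vdegU (i : 'I_E) x : vdeg U_(i)%MM x = (x \in enum_val i).
Proof.
rewrite /vdeg; have [h|h] := boolP (x \in enum_val i); last first.
  by rewrite big1 // => j hj; rewrite mnm1E; case: eqP => // e; rewrite e hj in h.
rewrite (bigD1 i) //= mnm1E eqxx big1 ?addn0 // => j /andP [_ ne].
by rewrite mnm1E eq_sym (negPf ne).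
Qed.

Lemma vdeg_sub u v x : (v <= u)%MM -> vdeg (u - v) x = (vdeg u x - vdeg v x)%N.
Proof. by move=> h; rewrite -{2}(submK h) vdegD addnK. Qed.

Lemma vdeg_gt0 u x : (0 < vdeg u x)%N -> exists2 i : 'I_E, (0 < u i)%N & x \in enum_val i.
Proof.
rewrite lt0n /vdeg sum_nat_eq0 => /forallPn [i]; rewrite negb_imply => /andP [h1 h2].
by exists i; rewrite // lt0n.
Qed.

Lemma sum_vdeg u : (\sum_x vdeg u x = 2 * mdeg u)%N.
Proof.
rewrite /vdeg (exchange_big_dep predT) //= mdegE big_distrr /=.
apply: eq_bigr => i _; rewrite big_const iter_addn_0 mulnC.
have card2 : #|enum_val i| = 2%N.
  by have /edgeP [a [b [h ->]]] := enum_valP i; rewrite cards2 (adj_neq h).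
by rewrite -card2; congr (_ * _)%N; apply: eq_card => y; rewrite !inE.
Qed.

Lemma vdeg_mdeg u v : vdeg u =1 vdeg v -> mdeg u = mdeg v.
Proof.
move=> h; apply/eqP; rewrite -(eqn_pmul2l (isT : (0 < 2)%N)) -!sum_vdeg.
by apply/eqP/eq_bigr.
Qed.

Definition inW (W : {set V}) (i : 'I_E) := enum_val i \subset W.

(** The edges outside [W] get private variables, so that the kernel of this
    monomial map is the extension to the polynomial ring of G of the toric ideal of
    the subgraph induced on [W]. *)
Definition edge_exp (W : {set V}) (i : 'I_E) : 'X_{1..#|V| + E} :=
  [multinom match split j with
            | inl a => ((enum_val a \in enum_val i) : nat)
            | inr k => ((~~ inW W i && (k == i)) : nat)
            end | j < #|V| + E].

Lemma edge_exp_eq W u v : wexp (edge_exp W) u = wexp (edge_exp W) v <->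
  (vdeg u =1 vdeg v /\ forall i, ~~ inW W i -> u i = v i).
Proof.
have hl u' x : wexp (edge_exp W) u' (lshift E (enum_rank x)) = vdeg u' x.
  rewrite wexpE /vdeg [RHS]big_mkcond; apply: eq_bigr => i _.
  rewrite mnmE (unsplitK (inl _)) enum_rankK.
  by case: ifP; rewrite ?mul1n ?mul0n.
have hr u' k : wexp (edge_exp W) u' (rshift #|V| k) = if inW W k then 0%N else u' k.
  rewrite wexpE (bigD1 k) //= big1 ?addn0 => [|i ne]; rewrite mnmE (unsplitK (inr _)).
    by rewrite eqxx andbT; case: ifP; rewrite ?mul1n ?mul0n.
  by rewrite eq_sym (negPf ne) andbF.
split=> [e|[h1 h2]].
  split=> [x|i hi]; first by rewrite -!hl e.
  by have := hr u i; rewrite e hr (negPf hi).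
apply/mnmP => j; rewrite -(splitK j); case: (split j) => [a|k] /=.
  by rewrite -[a]enum_valK !hl.
by rewrite !hr; case: ifP => // /negbT; apply: h2.
Qed.

Definition vertex_exp (i : 'I_E) : 'X_{1..#|V|} :=
  (\sum_(x in enum_val i) U_(enum_rank x))%MM.

Lemma toric_map_wmap p : @toric_map K V G p = wmap vertex_exp p.
Proof.
apply: eq_bigr => m _; congr (_ * _); apply: eq_bigr => i _; congr (_ ^+ _).
by rewrite /vertex_exp (big_morph (fun a => 'X_[K, a]) (@mpolyXD _ K) (@mpolyX0 _ K)).
Qed.

Lemma vertex_exp_eq u v : wexp vertex_exp u = wexp vertex_exp v <-> vdeg u =1 vdeg v.
Proof.
have h u' x : wexp vertex_exp u' (enum_rank x) = vdeg u' x.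
  rewrite wexpE /vdeg [RHS]big_mkcond; apply: eq_bigr => i _.
  rewrite /vertex_exp mnm_sumE; case: ifP => hx.
    rewrite (bigD1 x) //= mnm1E eqxx big1 ?addn0 ?mul1n // => y /andP [_ ne].
    by rewrite mnm1E (inj_eq enum_rank_inj) (negPf ne).
  rewrite big1 // => y hy; rewrite mnm1E (inj_eq enum_rank_inj).
  by case: eqP => // e; rewrite e hx in hy.
split=> [e x|e]; first by rewrite -!h e.
by apply/mnmP => j; rewrite -[j]enum_valK !h.
Qed.

Lemma toric_idealP u v : @toric_ideal K V G ('X_[u] - 'X_[v]) <-> vdeg u =1 vdeg v.
Proof. by rewrite /toric_ideal toric_map_wmap wmap_binomial vertex_exp_eq. Qed.

Lemma lem_mdeg_eq n (a b : 'X_{1..n}) : (a <= b)%MM -> (mdeg b <= mdeg a)%N -> a = b.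
Proof.
move=> h; rewrite -(submK h) mdegD -{2}[mdeg a]add0n leq_add2r leqn0 mdeg_eq0.
by move/eqP ->; rewrite add0m.
Qed.

(** If (u, v) is not primitive, it has a proper toric divisor (u', v').  Either this
    divisor has the same orientation as (u, v), or it is reversed and then
    (u - u', v - v') is not, since otherwise the orders of u and v would be
    exchanged.  So the orientation is kept while the degree drops. *)
Lemma exists_primitive (le : rel 'X_{1..E}) (hle : monomial_order le) u v :
  vdeg u =1 vdeg v -> u != v -> le v u -> exists u' v',
  [/\ (u' <= u)%MM, (v' <= v)%MM, le v' u' & primitive_binomial K (G := G) u' v'].
Proof.
have [n] := ubnP (mdeg u); elim: n u v => // n IH u v hn huv nuv luv.
case: (classic (exists u' v', [/\ @toric_binomial K V G u' v', (u' <= u)%MM, (v' <= v)%MM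
                   & (u', v') != (u, v)])) => [|h]; last first.
  exists u, v; rewrite !lepm_refl; split=> //; split.
    by split; [apply/eqP | apply/toric_idealP].
  move=> u' v' h1 h2 h3; have [[-> ->] //|ne] := eqVneq (u', v') (u, v).
  by case: h; exists u', v'.
case=> u' [v' [[/eqP nuv' /toric_idealP huv'] hu hv ne]].
have duv := vdeg_mdeg huv; have duv' := vdeg_mdeg huv'.
have [l|l] := boolP (le v' u').
  have hd : (mdeg u' < mdeg u)%N.
    rewrite ltnNge; apply: contra ne => hd; have eu := lem_mdeg_eq hu hd.
    by rewrite (lem_mdeg_eq hv) ?eu // -duv -duv' eu.
  have [|u2 [v2 [h1 h2 h3 h4]]] := IH u' v' _ huv' nuv' l.
    by apply: leq_trans hd _; rewrite -ltnS.
  by exists u2, v2; split=> //; [apply: lepm_trans h1 hu | apply: lepm_trans h2 hv].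
have {}l : le u' v' by have := mo_total hle u' v'; rewrite (negPf l) orbF.
have huv2 : vdeg (u - u') =1 vdeg (v - v') by move=> x; rewrite !vdeg_sub // huv huv'.
have u'0 : (0 < mdeg u')%N.
  rewrite lt0n mdeg_eq0; apply: contra nuv' => /eqP e; rewrite eq_sym e.
  by rewrite -mdeg_eq0 -duv' e mdeg0.
have hd : (mdeg (u - u') < mdeg u)%N.
  by rewrite -[in X in (_ < X)%N](submK hu) mdegD -addn1 leq_add2l.
have l2 : le (v - v')%MM (u - u')%MM.
  case/orP: (mo_total hle (v - v')%MM (u - u')%MM) => // l2.
  case/eqP: nuv; apply: (mo_anti hle) luv.
  by rewrite -(submK hu) -(submK hv) mo_add.
have nuv2 : (u - u')%MM != (v - v')%MM.
  apply: contra nuv => /eqP e; apply/eqP/(mo_anti hle) => //.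
  by rewrite -(submK hu) -(submK hv) e (mo_addl hle).
have [|u2 [v2 [h1 h2 h3 h4]]] := IH _ _ _ huv2 nuv2 l2.
  by apply: leq_trans hd _; rewrite -ltnS.
by exists u2, v2; split=> //; [apply: lepm_trans h1 (lem_subr _ _) | apply: lepm_trans h2 (lem_subr _ _)].
Qed.

Lemma primitive_disjoint u v i : primitive_binomial K (G := G) u v -> u i = 0%N \/ v i = 0%N.
Proof.
case=> [[/eqP ne /toric_idealP huv]] hmin.
have [|ui] := posnP (u i); [by left | have [|vi] := posnP (v i); [by right|exfalso]].
have hu : (U_(i) <= u)%MM by rewrite lep1mP -lt0n.
have hv : (U_(i) <= v)%MM by rewrite lep1mP -lt0n.
have [] := hmin (u - U_(i))%MM (v - U_(i))%MM; try exact: lem_subr.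
  split; last by apply/toric_idealP => x; rewrite !vdeg_sub // huv.
  by apply/eqP; apply: contra ne => /eqP e; rewrite -(submK hu) e submK.
by move/(congr1 (fun a : 'X_{1..E} => a i)); rewrite mnmBE mnm1E eqxx; lia.
Qed.

(** The product of every other edge of a list, starting at position [b]; its
    recursion by two edges at a time is [alt_mnm_cons]. *)
Definition alt_mnm (b : nat) (es : seq {set V}) : 'X_{1..E} :=
  (\sum_(j < (size es)./2) edge_mnm G (nth set0 es (b + j.*2)))%MM.

Lemma alt_mnm_cons b e1 e2 es : (b < 2)%N ->
  alt_mnm b [:: e1, e2 & es] = (edge_mnm G (nth set0 [:: e1; e2] b) + alt_mnm b es)%MM.
Proof.
move=> hb; rewrite /alt_mnm /= big_ord_recl /= addn0; congr (_ + _)%MM.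
  by case: b hb => [|[|]].
by apply: eq_bigr => j _; rewrite /bump /= add1n doubleS !addnS.
Qed.

Lemma edge_mnmU (i : 'I_E) : edge_mnm G (enum_val i) = U_(i)%MM.
Proof.
by apply/mnmP => j; rewrite mnmE mnm1E (inj_eq enum_val_inj) eq_sym.
Qed.

Definition step_edges x (s : seq V) y : seq {set V} :=
  [seq [set p.1; p.2] | p <- zip (x :: s) (rcons s y)].

Lemma shift_unit (a b p q r t : nat) :
  (a + (p + q) + r = b + (q + t) + p)%N -> (a + r = b + t)%N.
Proof. lia. Qed.

Lemma unshift_unit (a b p q r t : nat) :
  (a + r = b + t)%N -> (p + q + a + r = q + t + b + p)%N.
Proof. lia. Qed.

(** View u and v as multisets of red and blue edges.  The degree condition says that
    the walk which arrived at [x] still has to be closed up at [x0]: a red edge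
    leaves [x], since x has one more red end than blue, and for the same reason a
    blue edge leaves its other end z.  Two edges are used up, and the condition
    holds again at the new vertex, unless this is [x0]. *)
Lemma alternating_walk u v x x0 :
  (forall y, vdeg u y + (y == x0) = vdeg v y + (y == x))%N ->
  (x != x0) || (0 < vdeg u x)%N -> exists s : seq V,
  [/\ odd (size s), path (adj G) x (rcons s x0),
      (alt_mnm 0 (step_edges x s x0) <= u)%MM /\ (alt_mnm 1 (step_edges x s x0) <= v)%MM,
      alt_mnm 0 (step_edges x s x0) != 0%MM /\ 
      (forall y, vdeg (alt_mnm 0 (step_edges x s x0)) y + (y == x0) =
                 vdeg (alt_mnm 1 (step_edges x s x0)) y + (y == x))%N
    & forall y, y \in x :: s -> exists2 i : 'I_E, (0 < u i)%N & y \in enum_val i].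
Proof.
have [n] := ubnP (mdeg u); elim: n u v x => // n IH u v x hn huv hx.
have ux : (0 < vdeg u x)%N.
  by case/orP: hx => // ne; have := huv x; rewrite eqxx (negPf ne) addn0 addn1 => ->.
have [i ui xi] := vdeg_gt0 ux; have [z az ei] := edge_other xi.
have nz : z == x = false by rewrite eq_sym; apply/negbTE/adj_neq.
have hU : (U_(i) <= u)%MM by rewrite lep1mP -lt0n.
have hU2 y : vdeg U_(i)%MM y = ((y == x) + (y == z))%N.
  by rewrite vdegU ei !inE; case: (eqVneq y x) => [->|//]; rewrite eq_sym nz.
have uU y : vdeg u y = (vdeg (u - U_(i)) y + ((y == x) + (y == z)))%N.
  by rewrite -{1}(submK hU) vdegD hU2.
have vz : (0 < vdeg v z)%N.
  by have := huv z; rewrite uU eqxx nz addn0 add0n addn1 addSn => <-.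
have [j vj zj] := vdeg_gt0 vz; have [x' ax ej] := edge_other zj.
have hV : (U_(j) <= v)%MM by rewrite lep1mP -lt0n.
have nx' : x' == z = false by rewrite eq_sym; apply/negbTE/adj_neq.
have hV2 y : vdeg U_(j)%MM y = ((y == z) + (y == x'))%N.
  by rewrite vdegU ej !inE; case: (eqVneq y z) => [->|//]; rewrite eq_sym nx'.
have vU y : vdeg v y = (vdeg (v - U_(j)) y + ((y == z) + (y == x')))%N.
  by rewrite -{1}(submK hV) vdegD hV2.
have hu' : forall y, (vdeg (u - U_(i)) y + (y == x0) = vdeg (v - U_(j)) y + (y == x'))%N.
  by move=> y; have := huv y; rewrite uU vU; apply: shift_unit.
have nU (a : 'X_{1..E}) : (U_(i) + a)%MM != 0%MM by rewrite mnmD_eq0 mnm1_eq0.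
have hxz y : y \in [:: x; z] -> exists2 i : 'I_E, (0 < u i)%N & y \in enum_val i.
  by rewrite !inE => hy; exists i; rewrite // ei !inE.
have [e|ne] := eqVneq x' x0.
  have se : step_edges x [:: z] x0 = [:: enum_val i; enum_val j].
    by rewrite /step_edges /= ei ej e.
  exists [:: z]; rewrite se !alt_mnm_cons //= !edge_mnmU /alt_mnm !big_ord0 !addm0.
  split=> //; first by rewrite az -e ax.
  split=> [|y]; first by rewrite mnm1_eq0.
  by rewrite hU2 hV2 e -addnA addnC.
have [|||s [s1 s2 [s3 s4] [s5 s6] s7]] := IH (u - U_(i))%MM (v - U_(j))%MM x'; rewrite ?ne //.
  by move: hn; rewrite -{1}(submK hU) mdegD mdeg1 addn1 !ltnS.
have se : step_edges x (z :: x' :: s) x0 = [:: enum_val i, enum_val j & step_edges x' s x0].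
  by rewrite /step_edges /= ei ej.
exists [:: z, x' & s]; rewrite se !alt_mnm_cons //= !edge_mnmU.
split=> //=.
- by rewrite negbK.
- by rewrite az ax s2.
- by split; [rewrite -[X in (_ <= X)%MM](submK hU) | rewrite -[X in (_ <= X)%MM](submK hV)];
    rewrite addmC; apply/mnm_lepP => k; rewrite !mnmDE leq_add2r; apply/mnm_lepP: k.
- split=> // y; rewrite !vdegD hU2 hV2; apply: unshift_unit; apply: s6.
move=> y; rewrite -cat1s -[z :: _]cat1s catA mem_cat => /orP [/hxz //|/s7 [k hk hy]].
by exists k => //; apply: leq_trans hk _; rewrite mnmBE leq_subr.
Qed.

Lemma walk_edges_cons x s : walk_edges (x :: s) = step_edges x s x.
Proof. by rewrite /walk_edges rot1_cons. Qed.

Lemma walk_mnm1E w : walk_mnm1 G w = alt_mnm 0 (walk_edges w).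
Proof.
by rewrite /walk_mnm1 /alt_mnm /walk_edges size_map size_zip size_rot minnn.
Qed.

Lemma walk_mnm2E w : walk_mnm2 G w = alt_mnm 1 (walk_edges w).
Proof.
by rewrite /walk_mnm2 /alt_mnm /walk_edges size_map size_zip size_rot minnn.
Qed.

(** The alternating closed walk found inside (u, v) is a toric binomial dividing
    it, hence all of it by primitivity; it is not trivial because u and v have
    disjoint supports. *)
Lemma primitive_binomial_walk u v : primitive_binomial K (G := G) u v ->
  exists w, [/\ primitive_walk K G w, walk_mnm1 G w = u, walk_mnm2 G w = v
    & forall y, y \in w -> exists2 i : 'I_E, (0 < u i)%N & y \in enum_val i].
Proof.
move=> prim; have [[ne /toric_idealP huv] hmin] := prim.
have [x ux] : exists x, (0 < vdeg u x)%N.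
  have : (0 < mdeg u)%N.
    rewrite lt0n; apply/eqP => e; case: ne; have e' := vdeg_mdeg huv.
    by move/eqP: e (e); rewrite {2}e' mdeg_eq0 => /eqP -> /eqP; rewrite mdeg_eq0 => /eqP ->.
  rewrite -(ltn_pmul2l (isT : (0 < 2)%N)) muln0 -sum_vdeg lt0n sum_nat_eq0.
  by case/forallPn => x; rewrite negb_imply => /andP [_ h]; exists x; rewrite lt0n.
have [||s [s1 s2 [s3 s4] [s5 s6] s7]] := @alternating_walk u v x x.
- by move=> y; rewrite huv.
- by rewrite ux orbT.
exists (x :: s); rewrite -walk_edges_cons -?walk_mnm1E -?walk_mnm2E in s3 s4 s5 s6.
have [e1 e2] : walk_mnm1 G (x :: s) = u /\ walk_mnm2 G (x :: s) = v.
  apply: hmin => //; split; last by apply/toric_idealP => y; apply: (@addIn (y == x)).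
  move=> e; case/eqP: s5; apply/mnmP => k; rewrite mnm0E.
  have := mnm_lepP s3 k; have := mnm_lepP s4 k; rewrite -e.
  by case: (primitive_disjoint k prim) => ->; lia.
split=> //; split; last by rewrite e1 e2.
by split; rewrite //= ?s1.
Qed.

(** Removing from [a] and [a'] their common part leaves a toric binomial supported
    on edges inside [W], to which [exists_primitive] applies. *)
Lemma graver_divides (le : rel 'X_{1..E}) (hle : monomial_order le) (W : {set V}) a a' :
  a' != a -> le a' a -> vdeg a' =1 vdeg a -> (forall i, ~~ inW W i -> a' i = a i) ->
  exists w, [/\ primitive_walk K G w, {subset w <= W}, (walk_mnm1 G w <= a)%MM
                & in_mnm le (walk_binomial K G w) = walk_mnm1 G w].
Proof.
move=> ne l hd hW; have ea : (a - a' + a' = a' - a + a)%MM.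
  by apply/mnmP => i; rewrite !mnmDE !mnmBE; lia.
have h1 : vdeg (a - a') =1 vdeg (a' - a).
  by move=> x; have := congr1 (vdeg ^~ x) ea; rewrite /= !vdegD hd; apply: addIn.
have h2 : (a - a')%MM != (a' - a)%MM.
  by apply: contra ne => /eqP e; rewrite e in ea; rewrite (addmI ea).
have h3 : le (a' - a)%MM (a - a')%MM.
  case/orP: (mo_total hle (a' - a)%MM (a - a')%MM) => // h.
  case/eqP: ne; apply: (mo_anti hle l); rewrite -(mo_addl hle _ _ (a' - a)%MM) -ea.
  by rewrite (mo_addr hle).
have [u [v [hu hv luv prim]]] := exists_primitive hle h1 h2 h3.
have [w [pw e1 e2 hw]] := primitive_binomial_walk prim.
have [[/eqP nuv _] _] := prim.
exists w; rewrite /walk_binomial e1 e2; split=> //.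
- move=> y /hw [i ui yi]; have hi : inW W i.
    apply: contraLR ui => /hW e; rewrite -leqNgt; apply: leq_trans (mnm_lepP hu i) _.
    by rewrite mnmBE e subnn.
  exact: (subsetP hi).
- exact: lepm_trans hu (lem_subr _ _).
- exact: in_mnm_binomial.
Qed.

End Graver.

(** * Primitive walks of induced subgraphs *)

Section InducedSubgraph.
Variables (K : fieldType) (V : finType) (G : sgraph V) (W : {set V}).
Local Notation H := (induced G W).
Local Notation vW := {x : V | x \in W}.
Implicit Types (a b : 'X_{1..#|edges H|}).

Lemma induced_edge (i : 'I_#|edges H|) :
  exists j : 'I_#|edges G|, enum_val j = [set val x | x in enum_val i].
Proof.
have /edgeP [x [y [h e]]] := enum_valP i.
have hj : [set val x | x in enum_val i] \in edges G.
  by apply/edgeP; exists (val x), (val y); rewrite e imsetU1 imset_set1.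
by exists (enum_rank_in hj [set val x | x in enum_val i]); rewrite enum_rankK_in.
Qed.

Definition edge_val (i : 'I_#|edges H|) : 'I_#|edges G| :=
  sval (constructive_indefinite_description _ (induced_edge i)).

Lemma edge_valE i : enum_val (edge_val i) = [set val x | x in enum_val i].
Proof. exact: (svalP (constructive_indefinite_description _ (induced_edge i))). Qed.

Lemma edge_val_inj : injective edge_val.
Proof.
move=> i j /(congr1 enum_val); rewrite !edge_valE.
by move/(imset_inj val_inj)/enum_val_inj.
Qed.

Lemma edge_val_in i (x : vW) : (val x \in enum_val (edge_val i)) = (x \in enum_val i).
Proof. by rewrite edge_valE (mem_imset _ _ val_inj). Qed.

Lemma edge_val_inW i : inW W (edge_val i).
Proof. by apply/subsetP => x; rewrite edge_valE => /imsetP [y _ ->]; apply: valP. Qed.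

Definition push a : 'X_{1..#|edges G|} := (\sum_i U_(edge_val i) *+ a i)%MM.

Lemma push_edge_val a i : push a (edge_val i) = a i.
Proof.
rewrite /push mnm_sumE (bigD1 i) //= mulmnE mnm1E eqxx mul1n big1 ?addn0 //.
by move=> j ne; rewrite mulmnE mnm1E (inj_eq edge_val_inj) (negPf ne).
Qed.

Lemma push_out a j : (forall i, edge_val i != j) -> push a j = 0%N.
Proof.
move=> h; rewrite /push mnm_sumE big1 // => i _.
by rewrite mulmnE mnm1E (negPf (h i)).
Qed.

Lemma push_case (j : 'I_#|edges G|) :
  (exists i, j = edge_val i) \/ (forall i, edge_val i != j).
Proof.
have [/existsP [i /eqP <-]|/existsPn h] := boolP [exists i, edge_val i == j].
  by left; exists i.
by right.
Qed.

Lemma pushD a b : push (a + b) = (push a + push b)%MM.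
Proof.
apply/mnmP => j; case: (push_case j) => [[i ->]|h].
  by rewrite mnmDE !push_edge_val mnmDE.
by rewrite mnmDE !push_out.
Qed.

Lemma push0 : push 0%MM = 0%MM.
Proof.
apply/mnmP => j; case: (push_case j) => [[i ->]|h].
  by rewrite push_edge_val !mnm0E.
by rewrite push_out ?mnm0E.
Qed.

Lemma push_inj : injective push.
Proof. by move=> a b e; apply/mnmP => i; rewrite -!push_edge_val e. Qed.

Lemma push_le a b : (a <= b)%MM -> (push a <= push b)%MM.
Proof. by move=> h; rewrite -(submK h) pushD lem_addl. Qed.

Lemma push_vdeg a (x : vW) : vdeg (push a) (val x) = vdeg a x.
Proof.
rewrite /vdeg [RHS]big_mkcond [LHS]big_mkcond /=.
transitivity (\sum_(j in edge_val @: setT) if val x \in enum_val j then push a j else 0)%N.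
  rewrite [RHS]big_mkcond; apply: eq_bigr => j _.
  case: (push_case j) => [[i ->]|h]; first by rewrite imset_f ?inE.
  by rewrite push_out // !if_same.
rewrite big_imset => [|i j _ _ /edge_val_inj //]; apply: eq_big => [i|i _]; first by rewrite inE.
by rewrite edge_val_in push_edge_val.
Qed.

Lemma push_vdeg_out a y : y \notin W -> vdeg (push a) y = 0%N.
Proof.
move=> hy; rewrite /vdeg big1 // => j yj.
case: (push_case j) => [[i e]|]; last exact: push_out.
by case/negP: hy; apply: (subsetP (edge_val_inW i)); rewrite -e.
Qed.

Lemma push_vdeg_eq a b : vdeg (push a) =1 vdeg (push b) <-> vdeg a =1 vdeg b.
Proof.
split=> h x; first by rewrite -!push_vdeg.
have [xW|xW] := boolP (x \in W); last by rewrite !push_vdeg_out.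
by have := push_vdeg a (exist _ x xW); have := push_vdeg b (exist _ x xW) => /= -> ->.
Qed.

Lemma push_toric a b : toric_binomial K (G := G) (push a) (push b) <-> toric_binomial K (G := H) a b.
Proof.
split=> [[h1 /toric_idealP h2]|[h1 /toric_idealP h2]]; split.
- by move=> e; apply: h1; rewrite e.
- by apply/toric_idealP/push_vdeg_eq.
- by move/push_inj.
- by apply/toric_idealP/push_vdeg_eq.
Qed.

Lemma push_edge_mnm (e : {set vW}) : e \in edges H ->
  push (edge_mnm H e) = edge_mnm G [set val x | x in e].
Proof.
move=> he; rewrite -(enum_rankK_in he he); set i := enum_rank_in _ _.
rewrite -edge_valE !edge_mnmU; apply/mnmP => j.
case: (push_case j) => [[k ->]|h].
  by rewrite push_edge_val !mnm1E (inj_eq edge_val_inj).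
by rewrite push_out // mnm1E (negPf (h i)).
Qed.

Lemma walk_edges_val (w : seq vW) :
  walk_edges (map val w) = [seq [set val x | x in e] | e : {set vW} <- walk_edges w].
Proof.
have zip_val (s t : seq vW) :
    zip (map val s) (map val t) = [seq (val p.1, val p.2) | p <- zip s t].
  by elim: s t => [|x s IH] [|y t] //=; rewrite IH.
rewrite /walk_edges -map_rot zip_val -!map_comp; apply: eq_map => -[x y] /=.
by rewrite imsetU1 imset_set1.
Qed.

Lemma walk_edges_edges (T : finType) (F : sgraph T) (w : seq T) : cycle (adj F) w ->
  all [in edges F] (walk_edges w).
Proof.
case: w => // x s; rewrite walk_edges_cons /= /step_edges.
move: {2 4}x => y; elim: s x => [|z s IH] x /= /andP [h1 h2]; last first.
  by rewrite IH // andbT; apply/edgeP; exists x, z.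
by rewrite andbT; apply/edgeP; exists x, y.
Qed.

Lemma push_alt_mnm (w : seq vW) c : (c < 2)%N -> cycle (adj H) w ->
  push (alt_mnm H c (walk_edges w)) = alt_mnm G c (walk_edges (map val w)).
Proof.
move=> hc /walk_edges_edges; rewrite walk_edges_val /alt_mnm size_map.
move: (walk_edges w) => es /allP hes.
rewrite (big_morph push pushD push0); apply: eq_bigr => j _.
have hj : (c + j.*2 < size es)%N.
  have := ltn_ord j; have := odd_double_half (size es); lia.
by rewrite (nth_map set0) // push_edge_mnm // hes // mem_nth.
Qed.

Lemma lift_seq (w : seq V) : {subset w <= W} -> exists w' : seq vW, map val w' = w.
Proof.
elim: w => [|x w IH] h; first by exists [::].
have [|w' <-] := IH; first by move=> y hy; apply: h; rewrite in_cons hy orbT.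
by exists (exist _ x (h x (mem_head _ _)) :: w').
Qed.

(** A toric divisor in the induced subgraph is one in G, where the walk is
    primitive. *)
Lemma primitive_walk_induced (w : seq vW) :
  primitive_walk K G (map val w) -> primitive_walk K H w.
Proof.
case=> [[h1 h2 h3] [h4 h5]]; rewrite size_map in h1 h2.
have hc : cycle (adj H) w by rewrite cycle_map in h3.
rewrite walk_mnm1E walk_mnm2E -!push_alt_mnm // in h4 h5.
split=> //; split; rewrite walk_mnm1E walk_mnm2E; first exact/push_toric.
move=> a b hab ha hb.
by have [/push_inj -> /push_inj ->] := h5 _ _ (iffRL (push_toric a b) hab) (push_le ha) (push_le hb).
Qed.

Lemma walk_binomial_induced_ker (w : seq vW) : primitive_walk K H w ->
  wmap (edge_exp W) (walk_binomial K G (map val w)) = 0.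
Proof.
case=> [[_ _ hc] [[_ /toric_idealP h] _]]; apply/wmap_binomial/edge_exp_eq.
rewrite walk_mnm1E walk_mnm2E in h; rewrite walk_mnm1E walk_mnm2E -!push_alt_mnm //.
split=> [|j hj]; first exact/push_vdeg_eq.
have hj' i : edge_val i != j by apply: contraNneq hj => <-; apply: edge_val_inW.
by rewrite !push_out.
Qed.

End InducedSubgraph.

Lemma walk_equiv_in_mnm (K : fieldType) (V : finType) (G : sgraph V) w w'
    (le : rel 'X_{1..#|edges G|}) : monomial_order le -> walk_equiv K G w w' ->
  in_mnm le (walk_binomial K G w) = in_mnm le (walk_binomial K G w').
Proof. by move=> hle [-> //|->]; rewrite in_mnmN. Qed.

(** * The frame of glued Koszul complexes *)

Section KoszulFrame.
Variables (N : nat) (le : rel 'X_{1..N}) (hle : monomial_order le).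
Variables (r : nat) (u : 'I_r -> 'X_{1..N}) (t : 'I_r -> seq 'X_{1..N}).
Variable (blk : 'I_r -> nat).
Local Notation symbol := (option ('I_r * seq nat)).
Implicit Types (p q : 'I_r) (A : seq nat) (x y : symbol).

Fixpoint slex A B := match A, B with
  | a :: A', b :: B' => (a < b)%N || ((a == b) && slex A' B')
  | [::], _ :: _ => true
  | _, _ => false
  end.

Lemma slex_irr : irreflexive slex.
Proof. by elim=> //= a A ->; rewrite ltnn andbF. Qed.

Lemma slex_trans : transitive slex.
Proof.
elim=> [|b B IH] [|a A] [|c C] //=.
case/orP => [h1|/andP [/eqP -> h1]] /orP [h2|/andP [/eqP <- h2]].
- by rewrite (ltn_trans h1 h2).
- by rewrite h1.
- by rewrite h2.
- by rewrite eqxx (IH _ _ h1 h2) orbT.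
Qed.

Lemma slex_total A B : A != B -> slex A B || slex B A.
Proof.
elim: A B => [|a A IH] [|b B] //=; rewrite eqseq_cons.
by case: ltngtP => //= _ ne; apply: IH.
Qed.

(** The symbol Some (p, A) stands for the wedge of the elements of [t p] with
    indices in the increasing sequence A, in the Koszul complex attached to u_p;
    None is the generator of the polynomial ring.  Sequences, rather than sets, make
    removing the least index a mere tail and give the right order on the A. *)
Definition symbols : seq symbol := None ::
  [seq Some (p, A) | p <- enum 'I_r,
     A <- [seq mask (val m) (iota 0 (size (t p))) | m : (size (t p)).-tuple bool]].

Lemma mem_symbols p A : (Some (p, A) \in symbols) = subseq A (iota 0 (size (t p))).
Proof.
rewrite in_cons /=; apply/allpairsPdep/subseqP => [[p' [A' [_ /imageP [m _ ->] [-> ->]]]]|].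
  by exists m; rewrite ?size_tuple ?size_iota.
case=> m; rewrite size_iota => sm ->; exists p, (mask m (iota 0 (size (t p)))).
split=> //; first by rewrite mem_enum.
have sm' : size m == size (t p) by rewrite sm.
by apply/imageP; exists (Tuple sm').
Qed.

Definition sym_lt x y := match x, y with
  | Some (p, A), Some (q, B) => (p < q)%N || ((p == q) && slex A B)
  | None, Some _ => true
  | _, None => false
  end.
Definition sym_lvl x := if x is Some (_, A) then (size A).+1 else 0%N.
Definition sym_mu x := if x is Some (p, A)
  then (u p + \sum_(a <- A) nth 0%MM (t p) a)%MM else 0%MM.
Definition sym_pr x : symbol := if x is Some (p, _ :: A) then Some (p, A) else None.
Definition sym_blk x := if x is Some (p, _) then blk p else 0%N.

Lemma sym_lt_irr : irreflexive sym_lt.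
Proof. by case=> [[p A]|] //=; rewrite ltnn slex_irr andbF. Qed.

Lemma sym_lt_trans : transitive sym_lt.
Proof.
case=> [[q B]|] [[p A]|] [[p' A']|] //=.
case/orP => [h1|/andP [/eqP -> h1]] /orP [h2|/andP [/eqP <- h2]].
- by rewrite (ltn_trans h1 h2).
- by rewrite h1.
- by rewrite h2.
- by rewrite eqxx (slex_trans h1 h2) orbT.
Qed.

Lemma sym_lt_total x y : x != y -> sym_lt x y || sym_lt y x.
Proof.
case: x y => [[p A]|] [[q B]|] //= ne; rewrite -!val_eqE /=.
case: ltngtP => //= e; apply: slex_total; apply: contraNneq ne => ->.
by rewrite (val_inj e).
Qed.

Lemma sym_pr_mem x : x \in symbols -> sym_pr x \in symbols.
Proof.
case: x => [[p [|a A]]|] //; rewrite !mem_symbols.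
by apply: subseq_trans; apply: subseq_cons.
Qed.

Definition kbas : finType := seq_sub symbols.
Definition kbot : kbas := SeqSub (mem_head _ _).
Definition kpr (c : kbas) : kbas := SeqSub (sym_pr_mem (ssvalP c)).

Lemma sym_pr_mu x : (sym_mu (sym_pr x) <= sym_mu x)%MM.
Proof.
case: x => [[p [|a A]]|] /=; rewrite ?lem0m //.
by rewrite big_cons [(_ + \sum_(_ <- _) _)%MM in X in (_ <= X)%MM]addmC addmA lem_addr.
Qed.

Definition koszul_frame : frame le.
Proof.
refine (@Frame N le kbas (fun c c' => sym_lt (ssval c) (ssval c'))
  (fun c => sym_lvl (ssval c)) (fun c => sym_mu (ssval c)) kpr
  (fun c => sym_blk (ssval c)) kbot _ _ _ _ _ _ _ _ _) => //=.
- by move=> c; apply: sym_lt_irr.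
- by move=> c c' c''; apply: sym_lt_trans.
- by move=> c c'; rewrite -val_eqE; apply: sym_lt_total.
- by move=> c h; apply: val_inj => /=; case: (ssval c) h => [[]|].
- by move=> c; case: (ssval c) => [[p [|a A]]|].
- by move=> c _; apply: sym_pr_mu.
- by move=> c _; case: (ssval c) => [[p [|a A]]|].
Defined.

Hypothesis blk_mono : forall p q, (p <= q)%N -> (blk p <= blk q)%N.
Hypothesis t_coprime : forall p a b i, (a < size (t p))%N -> (b < size (t p))%N ->
  a != b -> nth 0%MM (t p) a i = 0%N \/ nth 0%MM (t p) b i = 0%N.
Hypothesis t_colon : forall p v, (u p <= v)%MM ->
  (exists2 q : 'I_r, (q < p)%N & (u q <= v)%MM) <-> (exists2 x, x \in t p & (u p + x <= v)%MM).

(** The elements of [t p] have disjoint supports, so their product divides a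
    monomial as soon as each of them does. *)
Lemma sym_mu_le p A v : subseq A (iota 0 (size (t p))) ->
  (sym_mu (Some (p, A)) <= v)%MM <->
  ((u p <= v)%MM /\ forall a, a \in A -> (u p + nth 0%MM (t p) a <= v)%MM).
Proof.
move=> hA; have uA : uniq A := subseq_uniq hA (iota_uniq _ _).
have lA a : a \in A -> (a < size (t p))%N by move/(mem_subseq hA); rewrite mem_iota.
split=> [h|[h1 h2]].
  split=> [|a ha]; apply: lepm_trans h; first exact: lem_addr.
  by rewrite /= (bigD1_seq a) //= addmA lem_addr.
apply/mnm_lepP => i; rewrite mnmDE mnm_sumE.
have [/hasP [a ha nz]|/hasPn h] := boolP (has (fun a => nth 0%MM (t p) a i != 0%N) A).
  rewrite (bigD1_seq a) //= big_seq_cond big1 ?addn0.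
    by have := mnm_lepP (h2 _ ha) i; rewrite mnmDE.
  move=> b /andP [hb ne]; rewrite eq_sym in ne.
  by have [e|//] := t_coprime i (lA _ ha) (lA _ hb) ne; rewrite e in nz.
rewrite big_seq_cond big1 ?addn0 ?(mnm_lepP h1) // => a; rewrite andbT => /h.
by rewrite negbK => /eqP.
Qed.

Lemma subseq_iota_cons n a A : (a < n)%N -> (forall b, b \in A -> (a < b)%N) ->
  subseq A (iota 0 n) -> subseq (a :: A) (iota 0 n).
Proof.
move=> ha hb hA; have -> : iota 0 n = iota 0 a ++ a :: iota a.+1 (n - a.+1).
  by rewrite -{2}[a]add0n -/(iota _ _.+1) -iotaD; congr iota; lia.
rewrite -[a :: A]cat0s; apply: cat_subseq; first exact: sub0seq.
rewrite /= eqxx.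
have <- : [seq x <- iota 0 n | (a < x)%N] = iota a.+1 (n - a.+1).
  have -> : n = (a.+1 + (n - a.+1))%N by lia.
  rewrite iotaD filter_cat add0n addKn.
  rewrite (eq_in_filter (a2 := pred0)) ?filter_pred0 => [|x]; last by rewrite mem_iota /=; lia.
  by rewrite (eq_in_filter (a2 := predT)) ?filter_predT => [|x]; last by rewrite mem_iota /=; lia.
rewrite subseq_filter hA andbT; apply/allP => b /hb //.
Qed.

(** Fix a value v and an index p, and let T be the set of elements of [t p] that
    divide v / u_p.  If T is empty, no earlier u_q divides v and (p, [::]) is upper.
    Otherwise let a0 be the least element of T: the symbols containing a0 are upper,
    because every smaller one over p must start with a0 too, and the others are
    matched by adding a0. *)
Lemma koszul_schreyer : schreyer_frame koszul_frame.
Proof.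
split=> [v [[[p A]|] hc] // _ hv|[[[p [|a [|b A]]]|] hc] // _ up]; last 2 first.
- (* (p, [::]) is dominated at this value by an earlier (q, [::]), with the same image *)
  have hA : subseq [:: a] (iota 0 (size (t p))) by rewrite -mem_symbols.
  have la : (a < size (t p))%N by have := mem_subseq hA (mem_head _ _); rewrite mem_iota.
  have hu : (u p <= sym_mu (Some (p, [:: a])))%MM by rewrite /= lem_addr.
  have [|q qp hq] := iffRL (t_colon hu).
    by exists (nth 0%MM (t p) a); rewrite ?mem_nth //= big_seq1 lepm_refl.
  have hq0 : Some (q, [::]) \in symbols by rewrite mem_symbols sub0seq.
  have := up (SeqSub hq0) erefl; rewrite /= big_nil addm0 => /(_ hq).
  by rewrite qp => /(_ isT).
- (* (p, b :: A) is dominated by (p, a :: A), with the same image (p, A) *)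
  have hA : subseq [:: a, b & A] (iota 0 (size (t p))) by rewrite -mem_symbols.
  have ab : (a < b)%N.
    have := subseq_sorted ltn_trans hA (iota_ltn_sorted _ _).
    by rewrite /= => /andP [].
  have hA' : Some (p, a :: A) \in symbols.
    rewrite mem_symbols; apply: subseq_trans hA.
    by apply: (@cat_subseq _ [:: a] A [:: a]); first exact: subseq_refl; apply: subseq_cons.
  have := up (SeqSub hA') erefl; rewrite /= ltnn !eqxx ab /= slex_irr.
  move=> h; suff: false by []; apply: h => //; rewrite !big_cons.
  by apply/mnm_lepP => i; rewrite !mnmDE; lia.
have hA : subseq A (iota 0 (size (t p))) by rewrite -mem_symbols.
have [hu hT] := iffLR (sym_mu_le v hA) hv.
pose T a := (u p + nth 0%MM (t p) a <= v)%MM.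
have lA a : a \in A -> (a < size (t p))%N by move/(mem_subseq hA); rewrite mem_iota.
have [hasT|/hasPn noT] := boolP (has T (iota 0 (size (t p)))); last first.
  left => -[[[q B]|] hq] //= [] hl hm; have A0 : A = [::].
    by case: A hT lA {hA hc hv hl} => // a A /(_ a (mem_head _ _)) hT /(_ a (mem_head _ _)) la;
      have := noT a; rewrite mem_iota => /(_ la); rewrite /T hT.
  move: hl; rewrite A0 => /size0nil B0; rewrite B0 /= andbF orbF => qp.
  have [|x xt hx] := iffLR (t_colon hu).
    by exists q => //; move: hm; rewrite B0 /= big_nil addm0.
  have := noT (index x (t p)); rewrite mem_iota /= add0n index_mem xt => /(_ isT).
  by rewrite /T nth_index // hx.
have [a0 [la0 Ta0 ha0]] : exists a0, [/\ (a0 < size (t p))%N, T a0 &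
    forall a, (a < size (t p))%N -> T a -> (a0 <= a)%N].
  have ex : exists a, (a < size (t p))%N && T a.
    by case/hasP: hasT => a; rewrite mem_iota add0n => /andP [_ la] Ta; exists a; rewrite la.
  exists (ex_minn ex); case: ex_minnP => a /andP [la Ta] h; split=> // b lb Tb.
  by apply: h; rewrite lb.
have upper_a0 A' (hA' : Some (p, a0 :: A') \in symbols) :
    upper (F := koszul_frame) v (SeqSub hA').
  move=> [[[q B]|] hq] //= [] hl hm; case: B hq hl hm => // b B hq [hl] hm /=.
  case/orP => [->//|/andP [/eqP e]]; subst q; rewrite ltnn eqxx /=.
  have sB : subseq (b :: B) (iota 0 (size (t p))) by rewrite -mem_symbols.
  have [_ hB] := iffLR (sym_mu_le v sB) hm.
  have lb : (b < size (t p))%N.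
    by have := mem_subseq sB (mem_head _ _); rewrite mem_iota.
  have := ha0 b lb (hB b (mem_head _ _)); rewrite leqNgt => /negPf -> /=.
  by case/andP.
case: A hc hA hv hT lA => [|a A] hc hA hv hT lA.
  right; have hA' : Some (p, [:: a0]) \in symbols.
    by rewrite mem_symbols; apply: subseq_iota_cons => //; apply: sub0seq.
  exists (SeqSub hA'); split=> //; first exact: val_inj.
  apply/sym_mu_le; first by rewrite -mem_symbols.
  by split=> // b; rewrite inE => /eqP ->.
have [e|ne] := eqVneq a a0.
  by left; move: (hc); rewrite e => hc'; have := upper_a0 _ hc'; congr upper; apply: val_inj; rewrite /= e.
have lt a' : a' \in a :: A -> (a0 < a')%N.
  move=> h; have h1 := ha0 a' (lA _ h) (hT _ h); rewrite ltn_neqAle h1 andbT.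
  apply: contraNneq ne => e; rewrite -e in h.
  have := ha0 a (lA _ (mem_head _ _)) (hT _ (mem_head _ _)).
  move: h; rewrite in_cons => /orP [/eqP -> //|h].
  have := subseq_sorted ltn_trans hA (iota_ltn_sorted _ _) => /=.
  by rewrite (path_sortedE ltn_trans) => /andP [/allP /(_ _ h) /= h2 _]; lia.
right; have hA' : Some (p, [:: a0, a & A]) \in symbols.
  by rewrite mem_symbols; apply: subseq_iota_cons.
exists (SeqSub hA'); split=> //; first exact: val_inj.
apply/sym_mu_le; first by rewrite -mem_symbols.
by split=> // b; rewrite in_cons => /orP [/eqP -> //|/hT].
Qed.

Variables (K : fieldType) (G : nat -> {mpoly K[N]} -> Prop) (f : 'I_r -> {mpoly K[N]}).

Definition koszul_gen (c : koszul_frame) : {mpoly K[N]} :=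
  if ssval c is Some (p, _) then f p else 0.

Hypotheses (G0 : forall b, G b 0)
  (G_add : forall b q g h, (blk q <= b)%N -> G b g -> G b (g + h * f q))
  (G_in : forall b g, g != 0 -> G b g ->
     exists2 q, (blk q <= b)%N & (u q <= in_mnm le g)%MM)
  (f_in : forall q, [/\ f q != 0, in_mnm le (f q) = u q
     & forall a, (f q)@_a != 0 -> mdeg a = mdeg (u q)]).

(** Among the indices q with u_q dividing an initial monomial, the least one gives an
    upper symbol; by monotonicity its block is not larger than that of the divisor
    at hand. *)
Lemma koszul_generators : generators G koszul_gen.
Proof.
have lvl1 (c : koszul_frame) : flvl c = 1%N -> exists q, ssval c = Some (q, [::]).
  by case: c => [[[q [|a A]]|] hc] // _; exists q.
split=> // [b c g h /lvl1 [q eq] hb hg|b g nz hg|c /lvl1 [q eq]].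
- by rewrite /koszul_gen eq; apply: G_add => //; move: hb; rewrite /= eq.
- have [q0 hq0 uq0] := G_in nz hg; have ex : exists n, [exists q : 'I_r,
      (val q == n) && (u q <= in_mnm le g)%MM].
    by exists (val q0); apply/existsP; exists q0; rewrite eqxx.
  case: (ex_minnP ex) => n /existsP [q /andP [/eqP en uq]] hmin.
  have hq : Some (q, [::]) \in symbols by rewrite mem_symbols sub0seq.
  exists (SeqSub hq); rewrite /= big_nil addm0; split=> //.
    apply: leq_trans hq0; apply: blk_mono; rewrite /= in en; rewrite en; apply: hmin.
    by apply/existsP; exists q0; rewrite eqxx.
  move=> [[[q' [|a A]]|] hc'] //= _; rewrite big_nil addm0 andbF orbF => uq' lt.
  have : (n <= q')%N by apply: hmin; apply/existsP; exists q'; rewrite eqxx.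
  by rewrite -en leqNgt lt.
have [h1 h2 h3] := f_in q; rewrite /koszul_gen /= eq /= big_nil addm0.
by split.
Qed.

Variable s : nat.
Hypothesis t_deg : forall p a, a \in t p -> mdeg a = s.

Lemma sym_mu_deg p A : Some (p, A) \in symbols ->
  mdeg (sym_mu (Some (p, A))) = (mdeg (u p) + s * size A)%N.
Proof.
rewrite mem_symbols => hA; rewrite /= mdegD mdeg_sum; congr (_ + _)%N.
rewrite (eq_big_seq (fun=> s)) => [|a ha]; first by rewrite big_const_seq count_predT iter_addn_0.
by apply: (@t_deg p); rewrite mem_nth //; have := mem_subseq hA ha; rewrite mem_iota.
Qed.

Lemma koszul_resolution T : (forall p, (blk p <= T)%N) ->
  (forall p q, (blk q <= blk p)%N -> mdeg (u q) <> (mdeg (u p) + s)%N) ->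
  exists d a, let C := FreeComplex (@fdeg N le koszul_frame) d a in
    graded_resolution (G T) C /\ forall i, @diffK K N C i = 0.
Proof.
move=> hT hs; apply: (frame_minimal_resolution hle koszul_schreyer koszul_generators).
  by case=> [[[p A]|] hc] //=.
move=> [[[p A]|] hc] [[[q B]|] hc'] // _ [e] hb e'; apply: (hs p q hb).
have e2 : mdeg (sym_mu (Some (p, A))) = mdeg (sym_mu (Some (q, B))) by exact: e'.
by move: e2; rewrite !sym_mu_deg // e /= mulnSr addnA addnAC => /addIn.
Qed.

End KoszulFrame.

(** * Monomial ideals and regular quotients *)

Section MonomialIdeals.
Variables (K : fieldType) (N : nat).
Local Notation S := {mpoly K[N]}.
Implicit Types (A : S -> Prop) (p : S) (v : 'X_{1..N}).

Lemma ideal_gen_coef A p v : (forall f, A f -> exists m, f = 'X_[m]) ->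
  ideal_gen A p -> p@_v != 0 -> exists2 m, A 'X_[m] & (m <= v)%MM.
Proof.
move=> hA [s [hs ->]]; rewrite raddf_sum /= => nz.
have [x xs] : exists2 x, x \in s & (x.1 * x.2)@_v != 0.
  apply/hasP; apply: contraNT nz => /hasPn h; rewrite big_seq big1 // => x /h.
  by rewrite negbK => /eqP.
have [m em] := hA _ (hs _ xs); rewrite em => /mcoeffM_ex [a [b [<- _]]].
rewrite mcoeffX; case: (m =P b) => [<- _|_]; last by rewrite eqxx.
by exists m; [rewrite -em; apply: hs | apply: lem_addl].
Qed.

Lemma ideal_gen_monomials A p : (forall v, p@_v != 0 -> exists2 m, A 'X_[m] & (m <= v)%MM) ->
  ideal_gen A p.
Proof.
move=> h; have : forall v, exists m, p@_v != 0 -> A 'X_[m] /\ (m <= v)%MM.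
  move=> v; have [e|nz] := eqVneq p@_v 0; first by exists 0%MM.
  by have [m h1 h2] := h _ nz; exists m.
move/(_ _)/constructive_indefinite_description => g.
exists [seq (p@_v *: 'X_[v - sval (g v)], 'X_[sval (g v)]) | v <- msupp p]; split.
  move=> x /mapP [v]; rewrite mcoeff_msupp => hv -> /=.
  by have [] := svalP (g v) hv.
rewrite big_map [LHS]mpolyE big_seq [RHS]big_seq; apply: eq_bigr => v.
rewrite mcoeff_msupp => hv /=; have [_ h2] := svalP (g v) hv.
by rewrite -scalerAl -mpolyXD submK.
Qed.

Lemma ideal_genX A v : (forall f, A f -> exists m, f = 'X_[m]) ->
  ideal_gen A 'X_[v] <-> exists2 m, A 'X_[m] & (m <= v)%MM.
Proof.
move=> hA; split=> [h|h].
  by apply: ideal_gen_coef hA h _; rewrite mcoeffX eqxx oner_eq0.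
apply: ideal_gen_monomials => v'; rewrite mcoeffX.
by case: (v =P v') => [<- //|_]; rewrite eqxx.
Qed.

Lemma mpolyX_inj : injective (fun m : 'X_{1..N} => 'X_[m] : S).
Proof.
move=> a b /(congr1 (mcoeff a)); rewrite !mcoeffX eqxx.
by case: (b =P a) => // _ /eqP; rewrite oner_eq0.
Qed.

(** If t_a and t_b share a variable x, then (t_a / x) t_b is a multiple of t_a, so
    regularity puts t_a / x in the ideal of the terms before t_b.  These have degree
    s, which is more than the degree of t_a / x. *)
Lemma regular_monomials_coprime s (t : seq 'X_{1..N}) a b i :
  (0 < s)%N -> (forall x, x \in t -> mdeg x = s) ->
  regular_sequence [seq 'X_[x] : S | x <- t] ->
  (a < b)%N -> (b < size t)%N -> nth 0%MM t a i = 0%N \/ nth 0%MM t b i = 0%N.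
Proof.
move=> hs ht [hreg _] ab bt; have at_ := ltn_trans ab bt.
have [|ai] := posnP (nth 0%MM t a i); [by left | have [|bi] := posnP (nth 0%MM t b i); [by right|exfalso]].
have hX f : f \in take b [seq 'X_[x] : S | x <- t] -> exists m, f = 'X_[m].
  by rewrite -map_take => /mapP [m _ ->]; exists m.
set ta := nth _ t a in ai; set tb := nth _ t b in bi.
have ha : (U_(i) <= ta)%MM by rewrite lep1mP -lt0n.
have hb : (U_(i) <= tb)%MM by rewrite lep1mP -lt0n.
have : ideal_gen (fun f => f \in take b [seq 'X_[x] : S | x <- t]) 'X_[ta - U_(i)].
  apply: hreg; rewrite ?size_map // (nth_map 0%MM) // -mpolyXD; apply/ideal_genX => //.
  exists ta; last first.
    apply/mnm_lepP => j; have := mnm_lepP ha j; have := mnm_lepP hb j.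
    by rewrite mnmDE mnmBE -/tb; lia.
  rewrite -map_take; apply/map_f.
  by rewrite /ta -(nth_take _ ab) mem_nth // size_take bt.
move/(ideal_genX _ hX) => [m]; rewrite -map_take => /mapP [m' m't /mpolyX_inj ->] hm.
have dm := ht _ (mem_take m't); have := ht _ (mem_nth 0%MM at_); rewrite -/ta => da.
have : (mdeg m' <= mdeg (ta - U_(i)))%N.
  by rewrite -(submK hm) mdegD leq_addl.
have := congr1 mdeg (submK ha); rewrite mdegD mdeg1 dm da; lia.
Qed.

Lemma regular_quotients_data (J : S -> Prop) s r (u : 'I_r -> 'X_{1..N}) :
  (0 < s)%N -> regular_quotients J s u -> exists t : 'I_r -> seq 'X_{1..N},
  [/\ forall (p : 'I_r) a, a \in t p -> mdeg a = s,
      forall (p : 'I_r) a b i, (a < size (t p))%N -> (b < size (t p))%N -> a != b ->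
        nth 0%MM (t p) a i = 0%N \/ nth 0%MM (t p) b i = 0%N
    & forall (p : 'I_r) v, (u p <= v)%MM ->
        (exists2 q : 'I_r, (q < p)%N & (u q <= v)%MM) <->
        (exists2 x, x \in t p & (u p + x <= v)%MM)].
Proof.
move=> hs [_ _ hq]; suff /fin_all_exists [t ht] : forall p : 'I_r, exists t : seq 'X_{1..N},
  [/\ forall a, a \in t -> mdeg a = s,
      forall a b i, (a < size t)%N -> (b < size t)%N -> a != b ->
        nth 0%MM t a i = 0%N \/ nth 0%MM t b i = 0%N
    & forall v, (u p <= v)%MM ->
        (exists2 q : 'I_r, (q < p)%N & (u q <= v)%MM) <->
        (exists2 x, x \in t & (u p + x <= v)%MM)].
  by exists t; split=> p; have [h1 h2 h3] := ht p.
move=> p; have [p0|/hq [t [t1 t2 t3]]] := posnP p.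
  exists [::]; split=> // v _; split=> [[q]|[x]] //.
  by rewrite p0.
exists t; split=> // [a b i ha hb|v hv].
  case: ltngtP => // ab _; first exact: regular_monomials_coprime hs t1 t2 ab hb.
  by have [] := regular_monomials_coprime i hs t1 t2 ab ha; [right | left].
have := t3 'X_[v - u p]; rewrite /colon -mpolyXD submK // !ideal_genX.
- move=> [h1 h2]; split=> [[q qp hq']|[x xt hx]].
    have [|m /mapP [x xt /mpolyX_inj ->] hm] := h1; first by exists (u q) => //; exists q.
    by exists x => //; rewrite -(submK hv) addmC; apply/mnm_lepP => i; rewrite !mnmDE leq_add2r (mnm_lepP hm).
  have [|m [q qp /mpolyX_inj ->] hm] := h2; last by exists q.
  exists x; first exact: map_f.
  by apply/mnm_lepP => i; have := mnm_lepP hx i; rewrite mnmDE mnmBE; lia.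
- by move=> f /mapP [x _ ->]; exists x.
- by move=> f [q _ ->]; exists (u q).
Qed.

Lemma graded_resolution_ext (I J : S -> Prop) C : same_ideal I J ->
  graded_resolution I C -> graded_resolution J C.
Proof. by move=> e [h1 h2 h3 h4]; split=> // p; rewrite -e. Qed.

End MonomialIdeals.

(** * The Betti numbers of the toric ideal *)

Lemma block_index (r m : nat) (k : nat -> nat) : k 0%N = 0%N -> k m = r ->
  forall q, (q < r)%N -> exists i : 'I_m, (k i <= q < k i.+1)%N.
Proof.
move=> k0 km q qr; have ex : exists i, (q < k i)%N by exists m; rewrite km.
case: (ex_minnP ex) => -[|i]; first by rewrite k0.
move=> h hmin; have im : (i < m)%N by apply: hmin; rewrite km.
exists (Ordinal im); rewrite /= h andbT leqNgt; apply/negP => /hmin; by rewrite ltnn.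
Qed.

Theorem theorem3p2 (K : fieldType) (V : finType) (G : sgraph V)
  (s : nat) (hs : (0 < s)%N)
  (r : nat) (C : 'I_r -> seq V) (hC : arranges_PC K G C)
  (le : rel 'X_{1..#|edges G|}) (hle : monomial_order le)
  (u : 'I_r -> 'X_{1..#|edges G|})
  (hu : forall p, u p = in_mnm le (walk_binomial K G (C p)))
  (h1 : regular_quotients (initial_ideal le (@toric_ideal K V G)) s u)
  (m : nat) (d : 'I_m -> nat) (hd : forall i, (0 < d i)%N) (hd_inj : injective d)
  (k : nat -> nat) (hk0 : k 0%N = 0%N) (hkm : k m = r)
  (hk : forall i, (i < m)%N -> (k i < k i.+1)%N)
  (h2deg : forall (i : 'I_m) (p : 'I_r), (k i <= p < k i.+1)%N -> mdeg (u p) = d i)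
  (h2ind : forall i : 'I_m, exists W : {set V}, PC_induced_is K G W C (k i.+1))
  (h3 : forall a b : 'I_m, (a < b)%N -> (d a)%:Z - (d b)%:Z <> s%:Z) :
  forall i j : nat,
    betti (@toric_ideal K V G) i j
    = betti (initial_ideal le (@toric_ideal K V G)) i j.
Proof.
have [hC1 hC2 hC3] := hC.
have [t [t_deg t_coprime t_colon]] := regular_quotients_data hs h1.
have /fin_all_exists [blk hblk] := fun q : 'I_r => block_index hk0 hkm (ltn_ord q).
have k_mono a b : (a <= b)%N -> (b <= m)%N -> (k a <= k b)%N.
  move=> ab; elim: b ab => [|b IH]; first by rewrite leqn0 => /eqP ->.
  rewrite leq_eqVlt => /orP [/eqP -> //|ab] bm.
  exact: leq_trans (IH ab (ltnW bm)) (ltnW (hk _ bm)).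
have blk_lt q (b : 'I_m) : (blk q <= b)%N = (q < k b.+1)%N.
  have /andP [h1' h2'] := hblk q; apply/idP/idP => h.
    by apply: leq_trans h2' _; apply: k_mono.
  by rewrite leqNgt; apply/negP => h'; have := k_mono _ _ h' (ltnW (ltn_ord _)); lia.
have blk_mono (p q : 'I_r) : (p <= q)%N -> (blk p <= blk q)%N.
  by move=> pq; rewrite blk_lt; apply: leq_ltn_trans pq _; have /andP [] := hblk q.
have degu q : mdeg (u q) = d (blk q) by apply: h2deg.
have /fin_all_exists [W hW] := h2ind.
have hmin (p q : 'I_r) : (blk q <= blk p)%N -> mdeg (u q) <> (mdeg (u p) + s)%N.
  rewrite !degu leq_eqVlt => /orP [/eqP /val_inj ->|/h3 h]; first lia.
  by move=> e; apply: h; rewrite e; lia.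
have hT q : (blk q <= m)%N by apply: ltnW.
pose fC q := walk_binomial K G (C q).
have fC_in q : [/\ fC q != 0, in_mnm le (fC q) = u q
    & forall a, (fC q)@_a != 0 -> mdeg a = mdeg (u q)].
  have [_ [[/eqP ne /toric_idealP tor] _]] := hC1 q.
  have nz : fC q != 0.
    by rewrite subr_eq0; apply: contra ne => /eqP /mpolyX_inj ->.
  have hdeg a : (fC q)@_a != 0 -> mdeg a = mdeg (walk_mnm1 G (C q)).
    rewrite mcoeffB !mcoeffX; case: (walk_mnm1 G (C q) =P a) => [-> //|_].
    case: (walk_mnm2 G (C q) =P a) => [<- _|_]; first by rewrite (vdeg_mdeg tor).
    by rewrite subrr eqxx.
  by split=> // a /hdeg ->; rewrite hu (hdeg _ (in_mnm_mem hle nz)).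
(* The filtration of the toric ideal: for a block b < m, the extension of the toric
   ideal of the induced subgraph W b, and the toric ideal itself at b = m. *)
pose Gt b (p : {mpoly K[#|edges G|]}) : Prop :=
  if insub b is Some i then wmap (edge_exp (W i)) p = 0 else toric_ideal p.
(* The same for the initial ideal, filtered by its generators. *)
pose Gm b (p : {mpoly K[#|edges G|]}) : Prop :=
  forall v, p@_v != 0 -> exists2 q, (blk q <= b)%N & (u q <= v)%MM.
have wmap0 n' m' (w : 'I_n' -> 'X_{1..m'}) : wmap (K := K) w 0 = 0 by rewrite /wmap mmap0.
have Gt0 b : Gt b 0.
  by rewrite /Gt; case: insub => [i|]; rewrite /toric_ideal ?toric_map_wmap wmap0.
have Gt_add b q g h : (blk q <= b)%N -> Gt b g -> Gt b (g + h * fC q).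
  move=> hb; rewrite /Gt; case: insubP => [i _ ei|_].
    rewrite -ei blk_lt in hb; have [_ /(_ _ hb) [w pw ew]] := hW i.
    move=> hg; apply: wmap_ideal => //; rewrite /fC.
    have := walk_binomial_induced_ker pw; case: ew => -> //.
    by rewrite /wmap mmapN => /eqP; rewrite oppr_eq0 => /eqP.
  rewrite /toric_ideal !toric_map_wmap => hg; apply: wmap_ideal => //.
  by rewrite -toric_map_wmap; have [_ [[_ h'] _]] := hC1 q.
have Gt_in b g : g != 0 -> Gt b g -> exists2 q, (blk q <= b)%N & (u q <= in_mnm le g)%MM.
  move=> nz; have gv := in_mnm_mem hle nz; rewrite /Gt.
  have main (X : {set V}) v' : v' != in_mnm le g -> g@_v' != 0 ->
      vdeg v' =1 vdeg (in_mnm le g) -> (forall i, ~~ inW X i -> v' i = in_mnm le g i) ->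
      exists w, [/\ primitive_walk K G w, {subset w <= X}
        & forall q, walk_equiv K G w (C q) -> (u q <= in_mnm le g)%MM].
    move=> ne gv' e1 e2.
    have [w [pw wX wle win]] := graver_divides K hle ne (in_mnm_max hle gv') e1 e2.
    by exists w; split=> // q /(walk_equiv_in_mnm hle); rewrite win hu => <-.
  case: insubP => [i _ ei|nb]; last first.
    rewrite /toric_ideal toric_map_wmap => hg.
    have [v' [ne gv' /vertex_exp_eq e]] := wmap_ker_support hg gv.
    have [|w [pw _ hw]] := main setT v' ne gv' e.
      by move=> i; rewrite /inW subsetT.
    have [q hq] := hC2 _ pw; exists q; last exact: hw.
    by apply: leq_trans (hT q) _; rewrite leqNgt.
  move=> hg; have [v' [ne gv' /edge_exp_eq [e1 e2]]] := wmap_ker_support hg gv.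
  have [w [pw wX hw]] := main (W i) v' ne gv' e1 e2.
  have [w' ew] := lift_seq wX; rewrite -ew in pw hw.
  have [/(_ w' (primitive_walk_induced pw)) [q hq eq] _] := hW i.
  by exists q; [rewrite -ei blk_lt | apply: hw].
have fm_in q : [/\ 'X_[u q] != 0 :> {mpoly K[#|edges G|]}, in_mnm le ('X_[u q] : {mpoly K[_]}) = u q
    & forall a, ('X_[u q] : {mpoly K[_]})@_a != 0 -> mdeg a = mdeg (u q)].
  split=> [||a]; last by rewrite mcoeffX; case: (u q =P a) => [->|] //; rewrite eqxx.
    by apply/eqP => /(congr1 (mcoeff (u q))) /eqP; rewrite mcoeffX eqxx mcoeff0 oner_eq0.
  exact: in_mnmX.
have Gm0 b : Gm b 0 by move=> v; rewrite mcoeff0 eqxx.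
have Gm_add b q g h : (blk q <= b)%N -> Gm b g -> Gm b (g + h * 'X_[u q]).
  move=> hb hg v; rewrite mcoeffD => nz.
  have [e|] := eqVneq g@_v 0; last exact: hg.
  move: nz; rewrite e add0r => /mcoeffM_ex [a [c [<- _]]]; rewrite mcoeffX.
  by case: (u q =P c) => [<- _|_]; [exists q; rewrite ?lem_addl | rewrite eqxx].
have Gm_in b g : g != 0 -> Gm b g -> exists2 q, (blk q <= b)%N & (u q <= in_mnm le g)%MM.
  by move=> nz; apply; apply: in_mnm_mem.
have [dt [at_ [rest mint]]] := koszul_resolution hle blk_mono t_coprime t_colon
  Gt0 Gt_add Gt_in fC_in t_deg hT hmin.
have [dm [am [resm minm]]] := koszul_resolution hle blk_mono t_coprime t_colon
  Gm0 Gm_add Gm_in fm_in t_deg hT hmin.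
move=> i j; have [e _ _] := h1.
have hI : same_ideal (Gt m) (@toric_ideal K V G).
  by move=> p; rewrite /Gt; case: insubP => // x; rewrite ltnn.
have hJ : same_ideal (Gm m) (initial_ideal le (@toric_ideal K V G)).
  move=> p; split=> [hp|/e hp v pv].
    apply/e/ideal_gen_monomials => v /hp [q _ hq]; exists (u q) => //; by exists q.
  have [|x [q /mpolyX_inj ->] hq] := ideal_gen_coef _ hp pv; last by exists q.
  by move=> f [q ->]; exists (u q).
rewrite (betti_resolution _ _ (graded_resolution_ext hI rest)).
rewrite (betti_resolution _ _ (graded_resolution_ext hJ resm)).
by rewrite (tor_dim_minimal _ _ mint) (tor_dim_minimal _ _ minm).
Qed.
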